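(* Consider the structured switched linear system $\dot x(t)=A_{\sigma(t)}x(t)+B_{\sigma(t)}u_{\sigma(t)}(t)$ with structured matrices $(A_i,B_i)_{i=1}^N$ and colored union graph $\mathcal G_c$. The following are equivalent: (a) every state vertex $x_i\in X$ is input-reachable in $\mathcal G_c$, and $\operatorname{grank}[A_1,\dots,A_N,B_1,\dots,B_N]=n$; (b) $\mathcal G_c$ contains a collection of vertex-disjoint generalized stems and generalized buds that cover $X$; (c) the system is structurally controllable.
   Context: System: $x(t)\in\mathbb R^n$, designable switching signal $\sigma:[0,\infty)\to[N]=\{1,\dots,N\}$, piecewise continuous input $u_{\sigma(t)}(t)\in\mathbb R^{m_{\sigma(t)}}$, $A_i$ of size $n\times n$, $B_i$ of size $n\times m_i$. A state $x$ is controllable if there exist finite $t_f$, a switching signal $\sigma:[0,t_f)\to[N]$ and an input with $x(0)=x$, $x(t_f)=0$; the system is controllable if all states are controllable. A structured matrix has entries either fixed zero or independent free real parameters; a realization assigns real values to the free entries; $\operatorname{grank}$ denotes the maximum rank over all realizations. The structured system is structurally controllable if some realization is controllable. Colored union graph $\mathcal G_c$: vertices $X=\{x_1,\dots,x_n\}$ and $U=\bigcup_iU_i$, $U_i=\{u^i_1,\dots,u^i_{m_i}\}$; for each $i$ and each nonzero entry $(j,k)$ of $A_i$ a state edge $(x_k,x_j)$ with color index $i$ (parallel edges of different colors allowed); for each nonzero entry $(j,k)$ of $B_i$ an input edge $(u^i_k,x_j)$ with color index $i$. A state vertex is input-reachable if some path from a vertex of $U$ reaches it. A set of edges is S-disjoint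 if their heads are all distinct and edges with the same tail have different color indices. A cycle is a closed walk whose only repeated vertex is its start/end (self-loops allowed). Generalized stem: a subgraph $(V_s,E_s)$ of $\mathcal G_c$ with exactly one input vertex in $V_s$ and no cycle, each state vertex of $V_s$ having exactly one ingoing edge in $E_s$, and with $E_s$ S-disjoint. Generalized bud: a subgraph $(V_s,E_s)$ with no input vertex and exactly one cycle, every state vertex of $V_s$ input-reachable in $\mathcal G_c$, each state vertex of $V_s$ having exactly one ingoing edge in $E_s$, and with $E_s$ S-disjoint. A collection of subgraphs covers $X$ if every vertex of $X$ lies in one of them. *)

(* Defs.v *)
From HB Require Import structures.
From mathcomp Require Import all_boot all_order all_algebra.
From mathcomp Require Import all_classical all_reals all_analysis.
From Stdlib Require Import Relations.

Set Implicit Arguments.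
Unset Strict Implicit.
Unset Printing Implicit Defensive.

Import Order.TTheory GRing.Theory Num.Theory.
Import numFieldTopology.Exports numFieldNormedType.Exports.
Local Open Scope ring_scope.

(* Structured system: n states, N modes, mode i has m i inputs.        *)
(* A structured matrix is a zero/nonzero pattern: a bool matrix, where *)
(* true = free (independent real) parameter, false = fixed zero.       *)

Section Graph.
Variables (n N : nat) (m : 'I_N -> nat).

Inductive vtx : Type :=
  | VX of 'I_n
  | VU (i : 'I_N) of 'I_(m i).

(* edges: state edge (x_k -> x_j) of color i, input edge (u^i_k -> x_j)
   of color i.  Heads are always state vertices. *)
Inductive edge : Type :=
  | SE (i : 'I_N) (k : 'I_n) (j : 'I_n)
  | IE (i : 'I_N) (k : 'I_(m i)) (j : 'I_n).

Definition etail (e : edge) : vtx :=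
  match e with SE _ k _ => VX k | IE i k _ => VU k end.
Definition ehead (e : edge) : 'I_n :=
  match e with SE _ _ j => j | IE _ _ j => j end.
Definition ecolor (e : edge) : 'I_N :=
  match e with SE i _ _ => i | IE i _ _ => i end.

Variables (A : 'I_N -> 'M[bool]_n) (B : forall i : 'I_N, 'M[bool]_(n, m i)).

Definition is_edge (e : edge) : Prop :=
  match e with
  | SE i k j => A i j k = true
  | IE i k j => B i j k = true
  end.

Definition adj (v w : vtx) : Prop :=
  exists e, is_edge e /\ etail e = v /\ VX (ehead e) = w.

Definition input_reachable (j : 'I_n) : Prop :=
  exists (i : 'I_N) (k : 'I_(m i)), clos_trans vtx adj (VU k) (VX j).

Definition subgraph (Vs : vtx -> Prop) (Es : edge -> Prop) : Prop :=
  forall e, Es e -> [/\ is_edge e, Vs (etail e) & Vs (VX (ehead e))].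

Definition S_disjoint (Es : edge -> Prop) : Prop :=
  forall e1 e2, Es e1 -> Es e2 -> e1 <> e2 ->
    ehead e1 <> ehead e2 /\ (etail e1 = etail e2 -> ecolor e1 <> ecolor e2).

(* a cycle in the graph with edge set Es: a closed walk e_0 ... e_{L-1}
   (L >= 1, self-loops allowed) whose vertices (the tails) are pairwise
   distinct, i.e. the only repeated vertex is the start/end. *)
Definition is_cycle (Es : edge -> Prop) (L : nat) (c : nat -> edge) : Prop :=
  [/\ (0 < L)%N,
      forall l, (l < L)%N -> Es (c l),
      forall l, (l < L)%N -> VX (ehead (c l)) = etail (c ((l.+1) %% L)%N) &
      forall l1 l2, (l1 < L)%N -> (l2 < L)%N ->
        etail (c l1) = etail (c l2) -> l1 = l2].

(* edge set of a cycle (cycles are identified up to rotation) *)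
Definition cycle_edges (L : nat) (c : nat -> edge) (e : edge) : Prop :=
  exists2 l, (l < L)%N & c l = e.

Definition no_cycle (Es : edge -> Prop) : Prop :=
  forall L c, ~ is_cycle Es L c.

Definition exactly_one_cycle (Es : edge -> Prop) : Prop :=
  exists L c, is_cycle Es L c /\
    forall L' c', is_cycle Es L' c' ->
      forall e, cycle_edges L' c' e <-> cycle_edges L c e.

Definition one_ingoing (Vs : vtx -> Prop) (Es : edge -> Prop) : Prop :=
  forall j, Vs (VX j) ->
    exists e, [/\ Es e, ehead e = j &
                  forall e', Es e' -> ehead e' = j -> e' = e].

Definition gen_stem (Vs : vtx -> Prop) (Es : edge -> Prop) : Prop :=
  [/\ subgraph Vs Es,
      (exists (i : 'I_N) (k : 'I_(m i)), Vs (VU k) /\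
         forall (i' : 'I_N) (k' : 'I_(m i')), Vs (VU k') -> VU k' = VU k),
      no_cycle Es,
      one_ingoing Vs Es &
      S_disjoint Es].

Definition gen_bud (Vs : vtx -> Prop) (Es : edge -> Prop) : Prop :=
  [/\ subgraph Vs Es,
      (forall (i : 'I_N) (k : 'I_(m i)), ~ Vs (VU k)),
      exactly_one_cycle Es,
      (forall j, Vs (VX j) -> input_reachable j) &
      one_ingoing Vs Es /\ S_disjoint Es].

Definition has_stem_bud_cover : Prop :=
  exists (K : nat) (Vs : nat -> vtx -> Prop) (Es : nat -> edge -> Prop),
    [/\ forall l, (l < K)%N -> gen_stem (Vs l) (Es l) \/ gen_bud (Vs l) (Es l),
        forall l1 l2, (l1 < K)%N -> (l2 < K)%N -> l1 <> l2 ->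
          forall v, Vs l1 v -> ~ Vs l2 v &
        forall j : 'I_n, exists2 l, (l < K)%N & Vs l (VX j)].

End Graph.

Section Realization.
Variable R : realType.

Definition realizes (r c : nat) (P : 'M[bool]_(r, c)) (M : 'M[R]_(r, c)) : Prop :=
  forall j k, P j k = false -> M j k = 0.

Variables (n N : nat) (m : 'I_N -> nat).

Definition big_AB (Ar : 'I_N -> 'M[R]_n) (Br : forall i : 'I_N, 'M[R]_(n, m i)) :=
  row_mx (\mxrow_(i < N) Ar i) (\mxrow_(i < N) Br i).

Definition grank_is (A : 'I_N -> 'M[bool]_n) (B : forall i : 'I_N, 'M[bool]_(n, m i))
    (r : nat) : Prop :=
  (exists Ar Br, (forall i, realizes (A i) (Ar i)) /\ (forall i, realizes (B i) (Br i))
                 /\ \rank (big_AB Ar Br) = r)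
  /\ (forall Ar Br, (forall i, realizes (A i) (Ar i)) -> (forall i, realizes (B i) (Br i))
                 -> (\rank (big_AB Ar Br) <= r)%N).

Definition partition (p : nat -> R) (K : nat) (tf : R) : Prop :=
  [/\ p 0%N = 0, p K = tf & forall l, (l < K)%N -> p l < p l.+1].

(* x0 can be steered to 0 in finite time by the switched system
   xdot = A_sigma x + B_sigma u_sigma (real matrices Ar, Br), with a
   switching signal having finitely many switches on [0, tf) and
   piecewise continuous inputs; the solution is continuous on [0,tf] and
   satisfies the ODE on each open piece of a partition. *)
Definition controllable_state (Ar : 'I_N -> 'M[R]_n)
    (Br : forall i : 'I_N, 'M[R]_(n, m i)) (x0 : 'cV[R]_n) : Prop :=
  exists (tf : R) (K : nat) (p : nat -> R),
    partition p K tf /\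
  exists (sigma : R -> 'I_N) (u : forall i : 'I_N, R -> 'cV[R]_(m i))
         (x : R -> 'cV[R]_n),
    [/\
        (forall l, (l < K)%N -> exists i, forall t, p l <= t < p l.+1 -> sigma t = i),
        (* inputs piecewise continuous: on each open piece they coincide with
           a continuous function (hence have one-sided limits at breakpoints) *)
        (forall l, (l < K)%N -> forall (i : 'I_N) (c : 'I_(m i)),
           exists g : R -> R, continuous g /\
             forall t, p l < t < p l.+1 -> u i t c 0 = g t),
        x 0 = x0 /\ x tf = 0,
        (forall j : 'I_n, {within [set t : R | 0 <= t <= tf]%classic,
                            continuous (fun t => x t j 0)}%classic) &
        (forall l, (l < K)%N -> forall t, p l < t < p l.+1 -> forall j : 'I_n,
           is_derive t 1 (fun s => x s j 0)
             ((Ar (sigma t) *m x t + Br (sigma t) *m u (sigma t) t) j 0))].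

Definition controllable (Ar : 'I_N -> 'M[R]_n)
    (Br : forall i : 'I_N, 'M[R]_(n, m i)) : Prop :=
  forall x0, controllable_state Ar Br x0.

Definition structurally_controllable (A : 'I_N -> 'M[bool]_n)
    (B : forall i : 'I_N, 'M[bool]_(n, m i)) : Prop :=
  exists Ar Br, (forall i, realizes (A i) (Ar i)) /\
                (forall i, realizes (B i) (Br i)) /\ controllable Ar Br.

End Realization.

(* Main.v *)
Require Import Defs.
From HB Require Import structures.
From mathcomp Require Import all_boot all_order all_algebra.
From mathcomp Require Import fingroup perm.
From mathcomp Require Import all_classical all_reals all_analysis.
From Stdlib Require Import Relations.

(** Full generic rank yields a matching: each state gets one ingoing edge, with
    pairwise distinct (tail, color) pairs, because some term of a nonzero
    n x n minor is nonzero.  Following matched edges backwards from a state ends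
    at an input or in a cycle; the components are the stems and the buds.

    From a matching to controllability, the cycles are removed one by one, the
    last one hit by a breadth-first search first.  The vertices of a removed
    cycle C act as inputs for the remaining states, through those of their
    columns that are not matched inside C; by induction the remaining system
    has a positive realization whose reachable space is everything.  Give the
    edges of C the weight 1/t, and let C be entered by a single further edge.
    As t tends to 0, the reachable space contains vectors tending to each basis
    vector of C, and then, modulo these, vectors tending to a spanning set of
    the remaining coordinates.  The approximating vectors are polynomial in t,
    so a determinant equal to 1 at t = 0 shows that the reachable space is
    everything for some t > 0.

    On the analytic side, the states reachable from 0 by a switching sequence
    of maximal rank absorb the transfer image of every other such space, and
    differentiating in the dwell times shows that these spaces together span
    the algebraic reachable space.  Conversely, if Q A_i = M_i Q and Q B_i = 0
    for all i, then Q x obeys a linear equation without input and vanishes at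
    the end of a trajectory only if it vanishes at the start; suitable Q detect
    both an unreachable state and a rank defect. *)

Set Implicit Arguments.
Unset Strict Implicit.
Unset Printing Implicit Defensive.

Import Order.TTheory GRing.Theory Num.Theory.
Import numFieldTopology.Exports numFieldNormedType.Exports.
Local Open Scope ring_scope.

(** * Polynomial families of subspaces *)

Section PolynomialFamilies.
Variables (R : realFieldType) (n : nat).

Definition ev (t : R) (p q : nat) (xi : 'M[{poly R}]_(p, q)) : 'M[R]_(p, q) :=
  map_mx (horner_eval t) xi.

Lemma evE t p q (xi : 'M[{poly R}]_(p, q)) i j : ev t xi i j = (xi i j).[t].
Proof. by rewrite mxE. Qed.

Lemma ev_polyC t p q (v : 'M[R]_(p, q)) : ev t (map_mx polyC v) = v.
Proof. by apply/matrixP => i j; rewrite !mxE /horner_eval hornerC. Qed.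

Lemma evD t p q (xi zeta : 'M[{poly R}]_(p, q)) :
  ev t (xi + zeta) = ev t xi + ev t zeta.
Proof. exact: map_mxD. Qed.

Lemma evZ t p q c (xi : 'M[{poly R}]_(p, q)) : ev t (c *: xi) = c.[t] *: ev t xi.
Proof. exact: map_mxZ. Qed.

Lemma evM t p q r (xi : 'M[{poly R}]_(p, q)) (zeta : 'M[{poly R}]_(q, r)) :
  ev t (xi *m zeta) = ev t xi *m ev t zeta.
Proof. exact: map_mxM. Qed.

Lemma ev_sum t p q (I : Type) (s : seq I) (P : pred I)
    (F : I -> 'M[{poly R}]_(p, q)) :
  ev t (\sum_(i <- s | P i) F i) = \sum_(i <- s | P i) ev t (F i).
Proof. exact: map_mx_sum. Qed.

(** A nonzero polynomial has fewer roots than its size, so one of the values 1, ..., [size p] is not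
    a root. *)
Lemma positive_nonroot (p : {poly R}) : p != 0 -> exists2 t, 0 < t & p.[t] != 0.
Proof.
move=> p0; apply: contrapT => H.
pose s := [seq (i.+1)%:R : R | i <- iota 0 (size p)].
have rs : all (root p) s.
  apply/allP => _ /mapP[i _ ->]; rewrite /root; apply: contraT => h.
  by case: H; exists i.+1%:R; rewrite ?ltr0n.
have us : uniq s.
  by rewrite map_inj_uniq ?iota_uniq // => i j /eqP; rewrite eqr_nat => /eqP[].
by have := max_poly_roots p0 rs us; rewrite size_map size_iota ltnn.
Qed.

Definition lin_closed (V : 'cV[R]_n -> Prop) :=
  V 0 /\ forall c v w, V v -> V w -> V (c *: v + w).

Lemma lin_closedD V v w : lin_closed V -> V v -> V w -> V (v + w).
Proof. by case=> _ H Vv Vw; rewrite -[v]scale1r; apply: H. Qed.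

Lemma lin_closedZ V c v : lin_closed V -> V v -> V (c *: v).
Proof. by case=> V0 H Vv; rewrite -[_ *: v]addr0; apply: H. Qed.

Lemma lin_closed_sum V (I : finType) (P : pred I) (F : I -> 'cV[R]_n) :
  lin_closed V -> (forall i, P i -> V (F i)) -> V (\sum_(i | P i) F i).
Proof.
move=> lV H; elim/big_ind: _ => //; first by case: lV.
by move=> x y; apply: lin_closedD.
Qed.

Lemma cV_sum_delta (K : pzRingType) (v : 'cV[K]_n) :
  v = \sum_x v x 0 *: delta_mx x 0.
Proof.
apply/matrixP => i j; rewrite ord1 summxE (bigD1 i) //= big1 ?addr0.
  by rewrite !mxE !eqxx mulr1.
by move=> k ki; rewrite !mxE eq_sym (negPf ki) mulr0.
Qed.

Lemma lin_closed_full V : lin_closed V -> (forall x, V (delta_mx x 0)) ->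
  forall v, V v.
Proof.
by move=> lV H v; rewrite (cV_sum_delta v); apply: lin_closed_sum => // x _;
  apply: lin_closedZ.
Qed.

(* The determinant of the matrix of approximants is a polynomial equal to 1 at 0. *)
Lemma poly_family_full (V : R -> 'cV[R]_n -> Prop) :
  (forall t, lin_closed (V t)) ->
  (forall x, exists2 xi : 'cV[{poly R}]_n,
     (forall t, t != 0 -> V t (ev t xi)) & ev 0 xi = delta_mx x 0) ->
  exists2 t, 0 < t & forall v, V t v.
Proof.
move=> lV H.
have /choice[xi Hxi] : forall x, exists xi : 'cV[{poly R}]_n,
    (forall t, t != 0 -> V t (ev t xi)) /\ ev 0 xi = delta_mx x 0.
  by move=> x; case: (H x) => xi h1 h2; exists xi.
pose X := \matrix_(i, j) xi j i 0.
have X0 : ev 0 X = 1%:M.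
  apply/matrixP => i j; rewrite !mxE.
  have /matrixP/(_ i 0) := (Hxi j).2.
  by rewrite !mxE => ->; rewrite eqxx andbT.
have dX0 : \det X != 0.
  apply: contraTneq isT => d0.
  have := congr1 (horner_eval (0:R)) d0.
  by rewrite -det_map_mx -/(ev 0 X) X0 det1 /horner_eval horner0 => /eqP; rewrite oner_eq0.
have [t t0 dt] := positive_nonroot dX0.
exists t => // v.
have uX : ev t X \in unitmx.
  by rewrite unitmxE /ev det_map_mx unitfE.
rewrite -[v]mul1mx -(mulmxV uX) -mulmxA.
set w := _ *m v.
have -> : ev t X *m w = \sum_j w j 0 *: ev t (xi j).
  apply/matrixP => i k; rewrite ord1 mxE summxE; apply: eq_bigr => j _.
  by rewrite !mxE mulrC.
apply: lin_closed_sum => // j _; apply: lin_closedZ => //.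
by apply: (Hxi j).1; rewrite gt_eqF.
Qed.

End PolynomialFamilies.

(** * Reachable vectors and reachable vertices relative to a vertex set *)

Section Reach.
Variables (R : realFieldType) (n : nat) (I J : Type).

(** Basis vectors outside [S] are granted for free, so fullness only concerns the coordinates in
    [S], and an induction can shrink [S] in a fixed dimension. *)
Inductive reach (S : {set 'I_n}) (A : I -> 'M[R]_n) (b : J -> 'cV[R]_n) :
    'cV[R]_n -> Prop :=
| reach_free x : x \notin S -> reach S A b (delta_mx x 0)
| reach_in j : reach S A b (b j)
| reach_step i v : reach S A b v -> reach S A b (A i *m v)
| reach_lin c v w : reach S A b v -> reach S A b w -> reach S A b (c *: v + w)
| reach_0 : reach S A b 0.

Lemma reach_closed S A b : lin_closed (reach S A b).
Proof. by split; [exact: reach_0 | move=> *; exact: reach_lin]. Qed.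

Inductive rch (S : {set 'I_n}) (PA : I -> 'I_n -> 'I_n -> bool)
    (PB : J -> 'I_n -> bool) : 'I_n -> Prop :=
| rch_in j x : x \in S -> PB j x -> rch S PA PB x
| rch_step i k x : rch S PA PB k -> x \in S -> PA i k x -> rch S PA PB x.

Lemma rch_mem S PA PB x : rch S PA PB x -> x \in S.
Proof. by case. Qed.

(** Matrix order against edge order: entry (j, k) belongs to the edge from [k] to [j]. *)
Definition patA (S : {set 'I_n}) (PA : I -> 'I_n -> 'I_n -> bool) i j k :=
  [&& k \in S, j \in S & PA i k j].
Definition patB (S : {set 'I_n}) (PB : J -> 'I_n -> bool) j x :=
  (x \in S) && PB j x.

(** Strict positivity on the whole pattern excludes cancellation along a path; the entry into a
    cycle relies on this. *)
Definition positive_real S PA PB (A : I -> 'M[R]_n) (b : J -> 'cV[R]_n) :=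
  (forall i j k, if patA S PA i j k then 0 < A i j k else A i j k == 0) /\
  (forall j x, if patB S PB j x then 0 < b j x 0 else b j x 0 == 0).

Definition nonneg_real S PA PB (A : I -> 'M[R]_n) (b : J -> 'cV[R]_n) :=
  (forall i j k, if patA S PA i j k then 0 <= A i j k else A i j k == 0) /\
  (forall j x, if patB S PB j x then 0 <= b j x 0 else b j x 0 == 0).

(** Add [t] times the 0/1 matrix of the pattern. Every derivation of a reachable vector replays with
    the perturbed data and yields a polynomial family through that vector at [t = 0], so fullness
    survives for some [t > 0]. *)
Lemma perturb_positive S PA PB A b :
  nonneg_real S PA PB A b -> (forall v, reach S A b v) ->
  exists A' b', positive_real S PA PB A' b' /\ forall v, reach S A' b' v.
Proof.
move=> [nA nb] full.
pose dA i : 'M[R]_n := \matrix_(j, k) (patA S PA i j k)%:R.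
pose db j : 'cV[R]_n := \col_x (patB S PB j x)%:R.
pose At t i := A i + t *: dA i; pose bt t j := b j + t *: db j.
have lift v : reach S A b v -> exists2 xi : 'cV[{poly R}]_n,
    (forall t, reach S (At t) (bt t) (ev t xi)) & ev 0 xi = v.
  elim=> {v} [x xS|j|i v _ [xi h1 h2]|c v w _ [xi h1 h2] _ [xi' h1' h2']|].
  - exists (map_mx polyC (delta_mx x 0)); last by rewrite ev_polyC.
    by move=> t; rewrite ev_polyC; exact: reach_free.
  - exists (map_mx polyC (b j) + 'X *: map_mx polyC (db j)).
      by move=> t; rewrite evD evZ !ev_polyC hornerX; exact: reach_in.
    by rewrite evD evZ !ev_polyC hornerX scale0r addr0.
  - exists ((map_mx polyC (A i) + 'X *: map_mx polyC (dA i)) *m xi).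
      by move=> t; rewrite evM evD evZ !ev_polyC hornerX; exact: reach_step.
    by rewrite evM evD evZ !ev_polyC hornerX scale0r addr0 h2.
  - exists (c%:P *: xi + xi').
      by move=> t; rewrite evD evZ hornerC; exact: reach_lin.
    by rewrite evD evZ hornerC h2 h2'.
  - exists (map_mx polyC 0); last by rewrite ev_polyC.
    by move=> t; rewrite ev_polyC; exact: reach_0.
have [t t0 ft] : exists2 t, 0 < t & forall v, reach S (At t) (bt t) v.
  apply: poly_family_full => [t|x]; first exact: reach_closed.
  by have [xi h1 h2] := lift _ (full (delta_mx x 0)); exists xi.
exists (At t), (bt t); split=> //; split=> [i j k|j x]; rewrite !mxE.
  by have := nA i j k; case: ifP => _ h; rewrite ?mulr1 ?mulr0 ?addr0 // ltr_wpDl.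
by have := nb j x; case: ifP => _ h; rewrite ?mulr1 ?mulr0 ?addr0 // ltr_wpDl.
Qed.

End Reach.

(** * Lifting along a cycle *)

Section CycleLift.
Variables (R : realFieldType) (n : nat) (I : eqType) (J : Type).
Variables (S C : {set 'I_n}) (f : 'I_n -> 'I_n) (mc : 'I_n -> I).
Hypothesis fC : forall c, c \in C -> f c \in C.
Hypothesis f_orbit : forall c c', c \in C -> c' \in C -> exists k, iter k f c = c'.
Hypothesis col_inj : forall c c', c \in C -> c' \in C ->
  mc c = mc c' -> f c = f c' -> c = c'.

(** [f c] is the predecessor of [c] on the cycle and [mc c] the color of the edge joining them;
    these are the columns occupied by cycle edges. *)
Definition cyc_col i k := [exists c in C, (mc c == i) && (f c == k)].

Definition cyc_mx (K : pzRingType) i : 'M[K]_n :=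
  \matrix_(j, k) [&& j \in C, mc j == i & f j == k]%:R.

Definition zeroC (v : 'cV[R]_n) : 'cV[R]_n :=
  \col_x (if x \in C then 0 else v x 0).

Lemma cyc_mulE (K : pzRingType) i (v : 'cV[K]_n) j :
  (cyc_mx K i *m v) j 0 = if (j \in C) && (mc j == i) then v (f j) 0 else 0.
Proof.
rewrite mxE; case: ifPn => h.
  rewrite (bigD1 (f j)) //= big1 ?addr0 => [|k kj].
    by rewrite mxE andbA h eqxx mul1r.
  by rewrite mxE andbA h eq_sym (negPf kj) mul0r.
by rewrite big1 // => k _; rewrite mxE andbA (negPf h) mul0r.
Qed.

(** Only the coordinate [f c] of [v] can be nonzero on the cycle, and by [col_inj] no row other than
    [c] reads it in mode [mc c]. *)
Lemma cyc_mul_delta (K : pzRingType) c (v : 'cV[K]_n) : c \in C ->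
  (forall x, x \in C -> x != f c -> v x 0 = 0) ->
  cyc_mx K (mc c) *m v = v (f c) 0 *: delta_mx c 0.
Proof.
move=> cC Hv; apply/matrixP => j k; rewrite ord1 cyc_mulE !mxE eqxx andbT.
have [->|jc] := eqVneq j c; first by rewrite cC eqxx mulr1.
rewrite mulr0; case: ifP => // /andP[jC /eqP mj]; apply: Hv; first exact: fC.
by apply: contra jc => /eqP fj; apply/eqP/col_inj.
Qed.

Lemma cyc_mul0 (K : pzRingType) i k (v : 'cV[K]_n) : ~~ cyc_col i k ->
  (forall x, x \in C -> x != k -> v x 0 = 0) -> cyc_mx K i *m v = 0.
Proof.
move=> nk Hv; apply/matrixP => j l; rewrite ord1 cyc_mulE [RHS]mxE.
case: ifP => // /andP[jC mj]; apply: Hv; first exact: fC.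
by apply: contra nk => fj; apply/existsP; exists j; rewrite jC mj.
Qed.

Variables (N A' : I -> 'M[R]_n) (b : J -> 'cV[R]_n) (b' : J + I * 'I_n -> 'cV[R]_n).

(** The weight 1/t lets the cycle dominate as [t] tends to 0; multiplied by [t], the matrix becomes
    polynomial. *)
Definition lift_mx (t : R) i := t^-1 *: cyc_mx R i + N i.

Local Notation At := lift_mx.

(** Membership is required only for nonzero [t]; the value at 0 is a limit of reachable vectors. *)
Definition approx (xi : 'cV[{poly R}]_n) :=
  forall t, t != 0 -> reach S (At t) b (ev t xi).

Local Notation P M := (map_mx polyC M).

Lemma approx_lin p xi zeta : approx xi -> approx zeta -> approx (p *: xi + zeta).
Proof. by move=> h1 h2 t t0; rewrite evD evZ; apply: reach_lin; [apply: h1|apply: h2]. Qed.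

Lemma approx_const v : (forall t, t != 0 -> reach S (At t) b v) -> approx (P v).
Proof. by move=> h t t0; rewrite ev_polyC; apply: h. Qed.

Lemma approx_sum (K : finType) (Q : pred K) (p : K -> {poly R}) xi :
  (forall k, Q k -> approx (xi k)) -> approx (\sum_(k | Q k) p k *: xi k).
Proof.
move=> h; elim/big_rec: _ => [t _|k x Qk hx].
  by rewrite /ev map_mx0; apply: reach_0.
by apply: approx_lin => //; apply: h.
Qed.

Lemma approx_cyc i xi : approx xi -> approx ((P (cyc_mx R i) + 'X *: P (N i)) *m xi).
Proof.
move=> h t t0; rewrite evM evD evZ !ev_polyC hornerX.
have -> : cyc_mx R i + t *: N i = t *: At t i.
  by rewrite /At scalerDr scalerA divff // scale1r.
rewrite -scalemxAl; apply: lin_closedZ; first exact: reach_closed.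
by apply: reach_step; apply: h.
Qed.

(** When the cycle part kills the family identically in [t], the pole 1/t disappears and a step of
    the lifted system is a step of [N]. *)
Lemma approx_N i xi : approx xi -> cyc_mx _ i *m xi = 0 -> approx (P (N i) *m xi).
Proof.
move=> h h0 t t0; rewrite evM ev_polyC.
have -> : N i *m ev t xi = At t i *m ev t xi.
  rewrite /At mulmxDl -scalemxAl.
  have -> : cyc_mx R i = ev t (cyc_mx _ i).
    by apply/matrixP => j k; rewrite !mxE rmorph_nat.
  by rewrite -evM h0 /ev map_mx0 scaler0 add0r.
by apply: reach_step; apply: h.
Qed.

Definition limit_vec v := exists2 xi, approx xi & ev 0 xi = v.

(** [A'] and [b'] describe the system left after removing [C], with an extra input for each column
    at a vertex of [C] not occupied by the cycle. Modulo the coordinates in [C], the lifted system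
    has to agree with it. *)
Hypothesis b'0 : forall i k, cyc_col i k || (k \notin C) -> b' (inr (i, k)) = 0.
Hypothesis Nb' : forall i k, k \in C -> ~~ cyc_col i k ->
  zeroC (N i *m delta_mx k 0) = zeroC (b' (inr (i, k))).
Hypothesis NA' : forall i v, zeroC v = v -> zeroC (N i *m v) = zeroC (A' i *m v).
Hypothesis A'0 : forall i v, A' i *m v = A' i *m zeroC v.
Hypothesis bb' : forall j, zeroC (b j) = zeroC (b' (inl j)).
Hypothesis full' : forall v, reach (S :\: C) A' b' v.

(** [z] is an entry into the cycle: independent of [t], reachable for all nonzero [t], and nonzero
    on [C] at [cs] only. *)
Variables (z : 'cV[R]_n) (cs : 'I_n).
Hypothesis csC : cs \in C.
Hypothesis z_cs : z cs 0 != 0.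
Hypothesis z_0 : forall c, c \in C -> c != cs -> z c 0 = 0.
Hypothesis z_reach : forall t, t != 0 -> reach S (At t) b z.

Lemma limit_cyc c (v : 'cV[R]_n) : c \in C -> v (f c) 0 != 0 ->
  (forall x, x \in C -> x != f c -> v x 0 = 0) ->
  limit_vec v -> limit_vec (delta_mx c 0).
Proof.
move=> cC vn0 v0 [xi axi exi].
exists (((v (f c) 0)^-1)%:P *: ((P (cyc_mx R (mc c)) + 'X *: P (N (mc c))) *m xi) + 0).
  apply: approx_lin; first exact: approx_cyc.
  by move=> t _; rewrite /ev map_mx0; apply: reach_0.
rewrite addr0 evZ evM evD evZ !ev_polyC hornerX hornerC scale0r addr0 exi.
by rewrite cyc_mul_delta // scalerA mulVf // scale1r.
Qed.

(** The vector [z] gives the basis vector of the successor of [cs], and each further step along the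
    dominating cycle moves to the next vertex. The induction is on the number of backward steps from
    [f c] to [cs]. *)
Lemma limit_cycle c : c \in C -> limit_vec (delta_mx c 0).
Proof.
move=> cC; have [k] := f_orbit (fC cC) csC.
elim: k c cC => [|k IH] c cC /=.
  move=> fc; apply: (@limit_cyc _ z); rewrite ?fc //.
  by exists (P z); rewrite ?ev_polyC //; apply: approx_const.
move=> h; apply: (@limit_cyc _ (delta_mx (f c) 0)) => //.
- by rewrite mxE !eqxx oner_eq0.
- by move=> x _ xf; rewrite mxE (negPf xf).
- by apply: IH; rewrite ?fC // -iterSr.
Qed.

(* The adjugate turns the approximants of the [e_c] into approximants whose
   C-block is an exact scalar matrix, without denominators. *)
Lemma normalized_approx : exists (d : {poly R}) (rr : 'I_n -> 'cV[{poly R}]_n),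
  d.[0] = 1 /\ forall c, c \in C -> [/\ approx (rr c), ev 0 (rr c) = delta_mx c 0 &
    forall y, y \in C -> rr c y 0 = d *+ (y == c)].
Proof.
have /choice[xi Hxi] : forall c, exists xi : 'cV[{poly R}]_n,
    c \in C -> approx xi /\ ev 0 xi = delta_mx c 0.
  move=> c; case: (boolP (c \in C)) => [cC|_]; last by exists 0.
  by have [xi h1 h2] := limit_cycle cC; exists xi.
pose G := \matrix_(i, j) (if j \in C then xi j i 0 else (i == j)%:R).
have G0 : ev 0 G = 1%:M.
  apply/matrixP => i j; rewrite !mxE; case: ifP => jC; last by rewrite rmorph_nat.
  have /matrixP/(_ i 0) := (Hxi j jC).2.
  by rewrite !mxE => ->; rewrite eqxx andbT.
have a0 : ev 0 (\adj G) = 1%:M.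
  by rewrite /ev map_mx_adj -/(ev 0 G) G0 -[\adj _]mul1mx mul_mx_adj det1.
exists (\det G), (fun c => \sum_(k in C) (\adj G) k c *: xi k); split.
  by rewrite -[LHS]/(horner_eval 0 _) -det_map_mx -/(ev 0 G) G0 det1.
move=> c cC; split.
- by apply: approx_sum => k kC; apply: (Hxi k kC).1.
- rewrite ev_sum (bigD1 c) //= big1 ?addr0 => [|k /andP[kC kc]].
    rewrite evZ (Hxi c cC).2.
    by have /matrixP/(_ c c) := a0; rewrite !mxE /horner_eval eqxx => ->; rewrite scale1r.
  by rewrite evZ; have /matrixP/(_ k c) := a0; rewrite !mxE /horner_eval (negPf kc) => ->; rewrite scale0r.
- move=> y yC; have /matrixP/(_ y c) := mul_mx_adj G.
  rewrite !mxE => <-; rewrite summxE [RHS](bigID (mem C)) /= [X in _ + X]big1 ?addr0.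
    by apply: eq_bigr => k kC; rewrite !mxE kC mulrC.
  by move=> k kC; rewrite !mxE (negPf kC); case: eqP => [yk|_]; rewrite ?mul0r // -yk yC in kC *.
Qed.

(** The C-coordinates vanish identically in [t], not just in the limit, so that [approx_N]
    applies. *)
Definition limit0_vec v :=
  exists2 xi, approx xi & (forall c, c \in C -> xi c 0 = 0) /\ ev 0 xi = v.

(** The C-block of [d *: xi] is removed exactly by subtracting the multiples [xi c 0] of [rr c];
    since [d] is 1 at 0, the limit only loses its coordinates in [C]. *)
Lemma limit_zeroC v : limit_vec v -> limit0_vec (zeroC v).
Proof.
move=> [xi axi exi]; have [d [rr [d0 Hr]]] := normalized_approx.
exists (d *: xi + (\sum_(c in C) (- xi c 0) *: rr c + 0)).
  apply: approx_lin => //; rewrite addr0.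
  by apply: approx_sum => c cC; case: (Hr c cC).
rewrite addr0; split=> [c cC|].
  rewrite mxE summxE (bigD1 c) //= big1 ?addr0 => [|k /andP[kC kc]].
    by rewrite !mxE; case: (Hr c cC) => _ _ ->//; rewrite eqxx mulr1n mulrC mulNr subrr.
  by rewrite !mxE; case: (Hr k kC) => _ _ ->//; rewrite eq_sym (negPf kc) mulr0.
rewrite evD evZ d0 scale1r exi ev_sum; apply/matrixP => x y; rewrite ord1 !mxE summxE.
under eq_bigr => c cC.
  have -> : ev 0 (- xi c 0 *: rr c) x 0 = - v c 0 * (x == c)%:R.
    rewrite evZ; case: (Hr c cC) => _ -> _; rewrite !mxE eqxx andbT hornerN.
    by rewrite -exi evE.
  over.
rewrite /=; case: ifP => xC.
  rewrite (bigD1 x) //= big1 ?addr0 ?eqxx ?mulr1 ?subrr // => k /andP[_ kx].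
  by rewrite eq_sym (negPf kx) mulr0.
rewrite big1 ?addr0 // => k kC; case: eqP => [xk|]; last by rewrite mulr0.
by rewrite xk kC in xC.
Qed.

Lemma zeroC_id (v : 'cV[R]_n) : (forall c, c \in C -> v c 0 = 0) -> zeroC v = v.
Proof.
by move=> h; apply/matrixP => x y; rewrite ord1 mxE; case: ifP => // /h.
Qed.

Lemma limit_lin c v w : limit_vec v -> limit_vec w -> limit_vec (c *: v + w).
Proof.
move=> [xi a1 e1] [zeta a2 e2]; exists (c%:P *: xi + zeta); first exact: approx_lin.
by rewrite evD evZ hornerC e1 e2.
Qed.

Lemma limit0_limit v : limit0_vec v -> limit_vec v.
Proof. by case=> xi h [_ e]; exists xi. Qed.

(** Induction on the derivation in the contracted system: each of its generators and steps is
    matched, modulo [C], by a limit in the lifted one. *)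
Lemma limit_reach v : reach (S :\: C) A' b' v -> limit_vec (zeroC v).
Proof.
have l0 : limit_vec 0.
  exists (P 0); last exact: ev_polyC.
  by apply: approx_const => t _; apply: reach_0.
have lz x : limit_vec x -> limit_vec (zeroC x).
  by move=> /limit_zeroC/limit0_limit.
elim=> {v} [x|[j|[i k]]|i v _ IH|c v w _ IHv _ IHw|].
- rewrite inE negb_and negbK => /orP[xC|xS]; apply: lz; first exact: limit_cycle.
  exists (P (delta_mx x 0)); last exact: ev_polyC.
  by apply: approx_const => t _; apply: reach_free.
- rewrite -bb'; apply: lz; exists (P (b j)); last exact: ev_polyC.
  by apply: approx_const => t _; apply: reach_in.
- case: (boolP (cyc_col i k || (k \notin C))) => [h|].
    by rewrite b'0 // zeroC_id // => c _; rewrite mxE.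
  rewrite negb_or negbK => /andP[nk kC]; rewrite -Nb' //; apply: lz.
  (* The C-block of [rr k] is [d] times the basis vector at [k], and no cycle edge of mode [i] reads
     column [k]; hence the cycle part kills [rr k]. *)
  have [d [rr [d0 Hr]]] := normalized_approx; have [h1 h2 h3] := Hr k kC.
  exists (P (N i) *m rr k); last by rewrite evM ev_polyC h2.
  apply: approx_N => //; apply: (cyc_mul0 nk) => x xC xk.
  by rewrite h3 // (negPf xk).
- have [xi h1 [h2 h3]] := limit_zeroC IH.
  have zz : zeroC (zeroC v) = zeroC v.
    by apply: zeroC_id => c cC; rewrite mxE cC.
  rewrite A'0 -NA' //; apply: lz; exists (P (N i) *m xi); last by rewrite evM ev_polyC h3 zz.
  apply: approx_N => //; apply/matrixP => x y; rewrite ord1 cyc_mulE mxE.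
  by case: ifP => // /andP[xC _]; apply: h2; apply: fC.
- have -> : zeroC (c *: v + w) = c *: zeroC v + zeroC w.
    by apply/matrixP => x y; rewrite !mxE; case: ifP => _; rewrite ?mulr0 ?addr0.
  exact: limit_lin.
- by rewrite zeroC_id // => c _; rewrite mxE.
Qed.

Lemma cycle_lift_full : exists2 t, 0 < t & forall v, reach S (At t) b v.
Proof.
apply: poly_family_full => [t|x]; first exact: reach_closed.
case: (boolP (x \in C)) => [xC|xC]; first exact: limit_cycle.
have <- : zeroC (delta_mx x 0) = delta_mx x 0.
  apply: zeroC_id => c cC; rewrite mxE; case: eqP => // cx.
  by rewrite -cx cC in xC.
exact: limit_reach.
Qed.

End CycleLift.

Lemma iter_mulSn_fix (T : Type) (f : T -> T) p x : iter p.+1 f x = x ->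
  forall k, iter (k * p.+1) f x = x.
Proof. by move=> h; elim=> [//|k IH]; rewrite mulSn iterD IH. Qed.

(** * Reinserting a removed cycle through a single entry edge *)

Section CycleStep.
Variables (R : realFieldType) (n : nat) (I J : eqType).
Variables (S C : {set 'I_n}) (f : 'I_n -> 'I_n) (mc : 'I_n -> I).
Variables (PA : I -> 'I_n -> 'I_n -> bool) (PB : J -> 'I_n -> bool).
Hypothesis CS : C \subset S.
Hypothesis fC : forall c, c \in C -> f c \in C.
Hypothesis f_orbit : forall c c', c \in C -> c' \in C -> exists k, iter k f c = c'.
Hypothesis col_inj : forall c c', c \in C -> c' \in C ->
  mc c = mc c' -> f c = f c' -> c = c'.
Hypothesis PAC : forall c, c \in C -> PA (mc c) (f c) c.

Local Notation S' := (S :\: C).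

(** A removed vertex [k] acts as one input per mode [i], except for the columns already used along
    the cycle. *)
Definition contracted_PB (j : J + I * 'I_n) x :=
  match j with
  | inl j => PB j x
  | inr (i, k) => [&& PA i k x, k \in C & ~~ cyc_col C f mc i k]
  end.

Variables (A' : I -> 'M[R]_n) (b' : J + I * 'I_n -> 'cV[R]_n).
Hypothesis posA' : positive_real S' PA contracted_PB A' b'.
Hypothesis full' : forall v, reach S' A' b' v.

Let A'0 i j k : (k \notin S') || (j \notin S') -> A' i j k = 0.
Proof.
move=> h; have := posA'.1 i j k; rewrite /patA.
by case/orP: h => /negPf ->; rewrite ?andbF => /eqP.
Qed.

Let A'_ge0 i j k : 0 <= A' i j k.
Proof. by have := posA'.1 i j k; case: ifP => _ => [/ltW|/eqP->]. Qed.

Let b'_ge0 j x : 0 <= b' j x 0.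
Proof. by have := posA'.2 j x; case: ifP => _ => [/ltW|/eqP->]. Qed.

Let b'0 j x : ~~ patB S' contracted_PB j x -> b' j x 0 = 0.
Proof. by move=> /negPf h; have := posA'.2 j x; rewrite h => /eqP. Qed.

Section Entry.
Variables (X : I -> 'M[R]_n) (Xb : J -> 'cV[R]_n).
Hypothesis HX : forall i j k, (X i j k == 0) ||
  [&& j \in C, k \in S', PA i k j & 0 < X i j k].
Hypothesis HXb : forall j x, (Xb j x 0 == 0) ||
  [&& x \in C, PB j x & 0 < Xb j x 0].

(** The columns of the extra inputs return as columns at vertices of [C], and [X] adds the entry
    edges into [C]. *)
Definition entry_N i := A' i + (\matrix_(j, k) b' (inr (i, k)) j 0) + X i.
Definition entry_b j := b' (inl j) + Xb j.

Local Notation At := (lift_mx C f mc entry_N).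

Lemma entry_N_supp i (v : 'cV[R]_n) : (forall c, c \in C -> v c 0 = 0) ->
  entry_N i *m v = A' i *m v + X i *m v.
Proof.
move=> v0; rewrite /entry_N !mulmxDl -[RHS]addr0 -!addrA; congr (_ + _).
rewrite addrC; congr (_ + _); apply/matrixP => x y; rewrite ord1 !mxE big1 // => k _.
rewrite mxE; case: (boolP (k \in C)) => kC; first by rewrite v0 ?mulr0.
by rewrite b'0 ?mul0r // /patB /= (negPf kC) andbF andbF.
Qed.

Lemma At_supp t i (v : 'cV[R]_n) : (forall c, c \in C -> v c 0 = 0) ->
  At t i *m v = A' i *m v + X i *m v.
Proof.
move=> v0; rewrite /lift_mx mulmxDl entry_N_supp // -scalemxAl.
rewrite (_ : cyc_mx _ _ _ _ _ *m v = 0) ?scaler0 ?add0r //.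
apply/matrixP => x y; rewrite ord1 cyc_mulE mxE.
by case: ifP => // /andP[xC _]; apply: v0; apply: fC.
Qed.

(** The hypotheses of the cycle lift hold by the supports of [A'], [b'], [X] and [Xb]; the resulting
    weights are sums of nonnegative terms on the pattern. *)
Lemma entry_step (z : 'cV[R]_n) cs : cs \in C -> z cs 0 != 0 ->
  (forall c, c \in C -> c != cs -> z c 0 = 0) ->
  (forall t, t != 0 -> reach S (At t) entry_b z) ->
  exists (A : I -> 'M[R]_n) (b : J -> 'cV[R]_n),
    nonneg_real S PA PB A b /\ forall v, reach S A b v.
Proof.
move=> csC zcs z0 zr.
have XC i j k : j \notin C -> X i j k = 0.
  by move=> /negPf jC; have := HX i j k; rewrite jC orbF => /eqP.
have XS i j k : k \notin S' -> X i j k = 0.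
  by move=> /negPf kC; have := HX i j k; rewrite kC andbF orbF => /eqP.
have b'0' i k : cyc_col C f mc i k || (k \notin C) -> b' (inr (i, k)) = 0.
  move=> h; apply/matrixP => x y; rewrite ord1 [RHS]mxE b'0 // /patB /=.
  by case/orP: h => [->|/negPf->]; rewrite ?andbF.
have NC i k : k \in C -> entry_N i *m delta_mx k 0 = b' (inr (i, k)).
  move=> kC; rewrite -colE; apply/matrixP => x y; rewrite ord1 !mxE.
  by rewrite A'0 ?XS ?add0r ?addr0 // inE kC.
have NA' i v : zeroC C v = v -> zeroC C (entry_N i *m v) = zeroC C (A' i *m v).
  move=> vz.
  rewrite entry_N_supp; last by move=> c cC; rewrite -vz mxE cC.
  apply/matrixP => x y; rewrite ord1 [LHS]mxE [RHS]mxE; case: ifPn => // xC.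
  rewrite mxE [X in _ + X]mxE big1 ?addr0 // => k _.
  by rewrite XC ?mul0r.
have A'z i v : A' i *m v = A' i *m zeroC C v.
  apply/matrixP => x y; rewrite ord1 !mxE; apply: eq_bigr => k _.
  rewrite mxE; case: ifP => // kC.
  by rewrite A'0 ?mul0r // inE kC.
have bb' j : zeroC C (entry_b j) = zeroC C (b' (inl j)).
  apply/matrixP => x y; rewrite ord1 !mxE; case: ifPn => // xC.
  by have := HXb j x; rewrite (negPf xC) orbF => /eqP->; rewrite addr0.
have [t t0 ft] := @cycle_lift_full R n I J S C f mc fC f_orbit col_inj
  entry_N A' entry_b b' b'0'
  (fun i k kC _ => congr1 (zeroC C) (NC i k kC)) NA' A'z bb' full' z cs csC zcs z0 zr.
exists (At t), entry_b; split=> //; split=> [i j k|j x]; rewrite !mxE.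
  case: (boolP (patA S PA i j k)) => [_|nP].
    have X0 : 0 <= X i j k by have := HX i j k; case/orP => [/eqP->|/and4P[_ _ _ /ltW]].
    by rewrite !addr_ge0 // mulr_ge0 ?ler0n // invr_ge0 ltW.
  rewrite (_ : [&& j \in C, _ & _] = false) ?mulr0 ?add0r.
    have -> : A' i j k = 0.
      have := posA'.1 i j k; rewrite (_ : patA _ _ _ _ _ = false) => [/eqP //|].
      apply: contraNF nP => /and3P[]; rewrite !inE => /andP[_ kS] /andP[_ jS] p.
      by rewrite /patA kS jS.
    have -> : b' (inr (i, k)) j 0 = 0.
      apply: b'0; apply: contra nP => /andP[]; rewrite inE => /andP[_ jS] /and3P[p kC _].
      by rewrite /patA jS (fintype.subsetP CS _ kC).
    rewrite !add0r; have := HX i j k; case/orP => // /and4P[jC]; rewrite inE => /andP[_ kS] p.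
    by rewrite /patA kS p (fintype.subsetP CS _ jC) in nP.
  apply: contraNF nP => /and3P[jC /eqP <- /eqP <-].
  by rewrite /patA PAC // !(fintype.subsetP CS) // fC.
case: (boolP (patB S PB j x)) => [_|nP].
  rewrite addr_ge0 //.
  by have := HXb j x; case/orP => [/eqP->|/and3P[_ _ /ltW]].
have -> : b' (inl j) x 0 = 0.
  apply: b'0; apply: contra nP => /andP[]; rewrite inE => /andP[_ xS] /= p.
  by rewrite /patB xS.
rewrite add0r; have := HXb j x; case/orP => // /and3P[xC p].
by rewrite /patB p (fintype.subsetP CS _ xC) in nP.
Qed.

End Entry.

(** The generator of [j0] vanished on [C]; with weight 1 added at [cs] it serves as the entry vector
    itself. *)
Lemma input_entry_step j0 cs : cs \in C -> PB j0 cs ->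
  exists (A : I -> 'M[R]_n) (b : J -> 'cV[R]_n),
    nonneg_real S PA PB A b /\ forall v, reach S A b v.
Proof.
move=> csC p.
pose Xb j : 'cV[R]_n := if j == j0 then delta_mx cs 0 else 0.
have bC c : c \in C -> b' (inl j0) c 0 = 0.
  by move=> cC; apply: b'0; rewrite /patB inE cC.
apply: (@entry_step (fun=> 0) Xb _ _ (entry_b Xb j0) cs) => //.
- by move=> i j k; rewrite mxE eqxx.
- move=> j x; rewrite /Xb; case: (eqVneq j j0) => [->|_]; rewrite mxE ?eqxx ?andbT //.
  by case: (eqVneq x cs) => [->|_]; rewrite ?eqxx ?csC ?p ?ltr01 ?orbT.
- by rewrite mxE bC // add0r /Xb eqxx mxE !eqxx oner_eq0.
- move=> c cC ccs; rewrite mxE bC // add0r /Xb eqxx mxE (negPf ccs) //.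
- by move=> t _; apply: reach_in.
Qed.

(** By contradiction: if no realization exists, a reachable vector independent of [t] and supported
    off [C] has coordinate 0 at [v], yet following a path to [v] produces one that is positive
    there. *)
Lemma state_entry_step i0 v cs : cs \in C -> rch S' PA PB v -> PA i0 v cs ->
  exists (A : I -> 'M[R]_n) (b : J -> 'cV[R]_n),
    nonneg_real S PA PB A b /\ forall v, reach S A b v.
Proof.
move=> csC rv p; have vS' := rch_mem rv.
pose X i : 'M[R]_n := if i == i0 then delta_mx cs v else 0.
have HX i j k : (X i j k == 0) || [&& j \in C, k \in S', PA i k j & 0 < X i j k].
  rewrite /X; case: (eqVneq i i0) => [->|_]; rewrite mxE ?eqxx //.
  case: (eqVneq j cs) => [->|_]; rewrite ?eqxx //.
  by case: (eqVneq k v) => [->|_]; rewrite ?eqxx // csC vS' p ltr01 orbT.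
have HXb (j : J) (x : 'I_n) : ((0 : 'cV[R]_n) x 0 == 0) ||
    [&& x \in C, PB j x & 0 < (0 : 'cV[R]_n) x 0].
  by rewrite mxE eqxx.
apply: contrapT => nz.
pose At := lift_mx C f mc (entry_N X).
(* A vector supported outside C that charges [v] enters C for the first time
   through the entry edge, hence with a coordinate independent of [t]. *)
have good (y : 'cV[R]_n) : (forall c, c \in C -> y c 0 = 0) ->
    (forall t, t != 0 -> reach S (At t) (entry_b (fun=> 0)) y) -> y v 0 = 0.
  move=> y0 yr; apply: contrapT => /eqP yv; apply: nz.
  have zE c : c \in C -> (A' i0 *m y + X i0 *m y) c 0 = y v 0 *+ (c == cs).
    move=> cC; rewrite mxE [X in X + _]mxE big1 ?add0r => [|k _].
      rewrite mxE (bigD1 v) //= big1 ?addr0 => [|k kv].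
        by rewrite /X eqxx mxE eqxx andbT mulr_natl.
      by rewrite /X eqxx mxE (negPf kv) andbF mul0r.
    by rewrite A'0 ?mul0r // !inE cC orbT.
  apply: (@entry_step X (fun=> 0) HX HXb (A' i0 *m y + X i0 *m y) cs csC).
  - by rewrite zE // eqxx mulr1n.
  - by move=> c cC ccs; rewrite zE // (negPf ccs).
  - move=> t t0; rewrite -(At_supp X t i0 y0); apply: reach_step; exact: yr.
(* The path starts at an original input and stays off [C]. By [good] the entry edge never sees its
   vectors, so every step is a step of [A'], free of [t], and nonnegativity prevents
   cancellation. *)
have walk x : rch S' PA PB x -> exists y : 'cV[R]_n, [/\ forall k, 0 <= y k 0, 0 < y x 0,
    forall c, c \in C -> y c 0 = 0 &
    forall t, t != 0 -> reach S (At t) (entry_b (fun=> 0)) y].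
  elim=> {x} [j x xS px|i k x /rch_mem kS [y [y_ge0 yk y0 yr]] xS px].
    exists (b' (inl j)); split=> // [|c cC|t t0].
    - by have := posA'.2 (inl j) x; rewrite /patB xS /= px.
    - by apply: b'0; rewrite /patB inE cC.
    - by have := reach_in S (At t) (entry_b (fun=> 0)) j; rewrite /entry_b addr0.
  have Xy : X i *m y = 0.
    apply/matrixP => r c; rewrite ord1 !mxE big1 // => l _; rewrite /X.
    case: ifP => _; rewrite mxE ?mul0r //.
    by case: (eqVneq l v) => [->|_]; rewrite ?(good y) ?mulr0 // andbF mul0r.
  exists (A' i *m y); split=> [r||c cC|t t0].
  - by rewrite mxE; apply: sumr_ge0 => l _; apply: mulr_ge0.
  - rewrite mxE (bigD1 k) //=; apply: ltr_wpDr.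
      by apply: sumr_ge0 => l _; apply: mulr_ge0.
    rewrite mulr_gt0 //; have := posA'.1 i x k.
    by rewrite /patA xS kS /= px.
  - rewrite mxE big1 // => l _; rewrite A'0 ?mul0r // !inE cC orbT //.
  - have := reach_step i (yr t t0); rewrite /At At_supp // Xy addr0 //.
by have [y [_ yv y0 yr]] := walk v rv; rewrite (good y) ?ltxx in yv.
Qed.

End CycleStep.

(** * Matchings with reachable states *)

Section Matching.
Variables (n : nat) (I J : finType).
Variables (S : {set 'I_n}) (PA : I -> 'I_n -> 'I_n -> bool) (PB : J -> 'I_n -> bool).
Variable mt : 'I_n -> (I * 'I_n) + J.

(** Each row of [S] receives a column of its own: a mode with a tail state in [S], or an input. *)
Definition matching :=
  (forall x, x \in S ->
     match mt x with inl (i, k) => (k \in S) && PA i k x | inr j => PB j x end) /\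
  {in S &, injective mt}.

(* Inputs have no parent: a vertex matched to an input is made its own parent. *)
Definition parent x := if mt x is inl (_, k) then k else x.
Definition state_matched x := if mt x is inl _ then true else false.
(** Requiring [state_matched] rules out the artificial loops at vertices matched to an input. *)
Definition cyclic x :=
  [&& x \in S, state_matched x & fconnect parent (parent x) x].
Definition orb x := [set y | fconnect parent x y].

Hypothesis Hm : matching.

Lemma parent_S x : x \in S -> parent x \in S.
Proof.
by move=> xS; have := Hm.1 x xS; rewrite /parent; case: (mt x) => [[i k] /andP[]|].
Qed.

Lemma iter_parent_S k x : x \in S -> iter k parent x \in S.
Proof. by move=> xS; elim: k => //= k; apply: parent_S. Qed.

Lemma iter_parentP x y : reflect (exists k, iter k parent x = y) (fconnect parent x y).
Proof.
apply: (iffP idP) => [/iter_findex <-|[k <-]]; first by eexists.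
exact: fconnect_iter.
Qed.

Lemma cyclic_back x y : fconnect parent (parent x) x -> fconnect parent x y ->
  fconnect parent y x.
Proof.
move=> /iter_parentP[p hp] /iter_parentP[k <-].
rewrite -iterSr in hp.
(* The [k] steps already made are completed to a multiple of the period [p.+1]. *)
apply/iter_parentP; exists (k * p.+1 - k)%N.
rewrite -iterD subnK ?iter_mulSn_fix //.
by rewrite leq_pmulr.
Qed.

Lemma input_matched_fix x k : ~~ state_matched x -> iter k parent x = x.
Proof.
move=> h; elim: k => //= k ->; move: h; rewrite /state_matched /parent.
by case: (mt x) => //.
Qed.

Lemma cyclic_orb x y : cyclic x -> fconnect parent x y -> cyclic y.
Proof.
move=> /and3P[xS xm xc] xy; have yx := cyclic_back xc xy.
apply/and3P; split.
- by case/iter_parentP: xy => k <-; apply: iter_parent_S.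
- apply: contraT => ny; case/iter_parentP: yx => k.
  by rewrite input_matched_fix // => yx; rewrite yx xm in ny.
- case/iter_parentP: xc => p; rewrite -iterSr => hp.
  case/iter_parentP: xy => k <-; apply/iter_parentP; exists p.
  by rewrite -iterSr -iterD addnC iterD hp.
Qed.

(** Iterating [parent] on a finite set must loop, either at an input-matched fixed point or on a
    genuine cycle. *)
Lemma eventually_cyclic x : x \in S -> exists k,
  ~~ state_matched (iter k parent x) \/ cyclic (iter k parent x).
Proof.
move=> xS; have /trajectP[k kl hk] := looping_order parent x.
exists k; case: (boolP (state_matched (iter k parent x))) => h; [right|by left].
apply/and3P; split => //; first exact: iter_parent_S.
apply/iter_parentP; exists (fingraph.order parent x - k).-1.
rewrite -iterSr prednK ?subn_gt0 // -iterD subnK ?(ltnW kl) //.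
Qed.

(** Breadth-first search: the vertices reached from an input inside [S] by at most [l] edges. *)
Fixpoint lev l : {set 'I_n} :=
  if l is l'.+1 then
    lev l' :|: [set x in S | [exists j, PB j x] || [exists i, exists k in lev l', PA i k x]]
  else finset.set0.

Lemma lev_leq l l' : (l <= l')%N -> lev l \subset lev l'.
Proof.
move=> /subnK <-; elim: (l' - l)%N => //= k IH.
by apply: fintype.subset_trans IH _; apply: finset.subsetUl.
Qed.

Lemma rch_lev x : rch S PA PB x -> exists l, x \in lev l.
Proof.
elim=> {x} [j x xS p|i k x _ [l kl] xS p].
  by exists 1%N; rewrite /= !inE xS /=; apply/orP; left; apply/existsP; exists j.
exists l.+1; rewrite /= !inE xS /=; apply/orP; right; apply/orP; right.
by apply/existsP; exists i; apply/existsP; exists k; rewrite kl.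
Qed.

Hypothesis Hr : forall x, x \in S -> rch S PA PB x.

Lemma lev_bound : exists M, S \subset lev M.
Proof.
have /choice[l hl] : forall x, exists l, x \in S -> x \in lev l.
  move=> x; case: (boolP (x \in S)) => [/Hr/rch_lev[l hl]|_]; first by exists l.
  by exists 0%N.
exists (\max_x l x)%N; apply/fintype.subsetP => x /hl; apply/fintype.subsetP.
by apply: lev_leq; apply: leq_bigmax.
Qed.

(* The cycle that a breadth-first search from the inputs hits last. *)
Lemma last_cycle x0 : cyclic x0 -> exists x D, [/\ cyclic x,
  forall y, y \in orb x -> y \notin lev D &
  forall y, cyclic y -> exists2 h, h \in orb y & h \in lev D.+1].
Proof.
move=> cx0; have [M hM] := lev_bound.
(* [D] will be the largest depth at which some cycle is still untouched; depth 0 qualifies because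
   [lev 0] is empty, and [M] bounds such depths. *)
pose P D := [exists x, cyclic x && [disjoint orb x & lev D]].
have exP : exists D, P D.
  exists 0%N; apply/existsP; exists x0; rewrite cx0 /=.
  by apply/pred0P => y /=; rewrite !inE andbF.
have leP D : P D -> (D <= M)%N.
  move=> /existsP[x /andP[cx dx]]; rewrite leqNgt; apply/negP => MD.
  have xS : x \in S by case/and3P: cx.
  have := disjointFr dx (_ : x \in orb x); rewrite inE connect0 => /(_ isT).
  by rewrite (fintype.subsetP (lev_leq (ltnW MD))) // (fintype.subsetP hM).
case: (ex_maxnP exP leP) => D /existsP[x /andP[cx dx]] maxD.
exists x, D; split=> // [y yx|y cy]; first by rewrite (disjointFr dx).
apply: contrapT => nh.
suff /maxD : P D.+1 by rewrite ltnn.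
apply/existsP; exists y; rewrite cy /=.
apply/pred0P => h /=; apply: negbTE; apply/negP => /andP[h1 h2].
by apply: nh; exists h.
Qed.

End Matching.

(** Give weight 1 to the matched edges only. Matched columns being distinct, a mode sends the basis
    vector of a parent exactly to that of its child, so each basis vector is reached from an
    input-matched ancestor. *)
Lemma acyclic_full (R : realFieldType) n (I J : finType) (S : {set 'I_n})
    (PA : I -> 'I_n -> 'I_n -> bool) (PB : J -> 'I_n -> bool) mt :
  matching S PA PB mt -> (forall x, ~~ cyclic S mt x) ->
  exists (A : I -> 'M[R]_n) (b : J -> 'cV[R]_n),
    nonneg_real S PA PB A b /\ forall v, reach S A b v.
Proof.
move=> Hm nc.
pose A i : 'M[R]_n := \matrix_(j, k) ((j \in S) && (mt j == inl (i, k)))%:R.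
pose b j : 'cV[R]_n := \col_x ((x \in S) && (mt x == inr j))%:R.
exists A, b; split.
  split=> [i j k|j x]; rewrite mxE; case: ifPn => [_|np]; rewrite ?ler0n //.
    rewrite pnatr_eq0 eqb0; apply: contra np => /andP[jS /eqP mj].
    by have := Hm.1 j jS; rewrite mj /patA jS => /andP[-> ->].
  rewrite pnatr_eq0 eqb0; apply: contra np => /andP[xS /eqP mx].
  by have := Hm.1 x xS; rewrite mx /patB xS.
apply: lin_closed_full => [|x]; first exact: reach_closed.
case: (boolP (x \in S)) => xS; last exact: reach_free.
have [k] := eventually_cyclic Hm xS.
case=> [|c]; last by case/negP: (nc (iter k (parent mt) x)).
elim: k x xS => [|k IH] x xS.
  rewrite /= /state_matched; case mx: (mt x) => [//|j] _.
  have -> : delta_mx x 0 = b j; last exact: reach_in.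
  apply/matrixP => y z; rewrite ord1 !mxE eqxx andbT; congr (_%:R); congr nat_of_bool.
  apply/eqP/andP => [->|[yS /eqP my]]; first by rewrite xS mx.
  by apply: (Hm.2) => //; rewrite my.
rewrite iterSr => /(IH _ (parent_S Hm xS)).
case mx: (mt x) => [[i y]|j]; last by rewrite /parent mx.
rewrite {1}/parent mx => hy.
have -> : delta_mx x 0 = A i *m delta_mx y 0 :> 'cV[R]_n; last exact: reach_step.
rewrite -colE; apply/matrixP => u z; rewrite ord1 !mxE eqxx andbT; congr (_%:R); congr nat_of_bool.
apply/eqP/andP => [->|[uS /eqP mu]]; first by rewrite xS mx.
by apply: (Hm.2) => //; rewrite mu.
Qed.

(** Strong induction on the size of [S]. The input type [J] is quantified inside because removing a
    cycle creates new inputs. *)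
Theorem matched_rch_full (R : realFieldType) n (I : finType) (S : {set 'I_n})
    (PA : I -> 'I_n -> 'I_n -> bool) :
  forall (J : finType) (PB : J -> 'I_n -> bool) mt,
  matching S PA PB mt -> (forall x, x \in S -> rch S PA PB x) ->
  exists (A : I -> 'M[R]_n) (b : J -> 'cV[R]_n),
    positive_real S PA PB A b /\ forall v, reach S A b v.
Proof.
have [k] := ubnP #|S|; elim: k S => // k IHk S cS J PB mt Hm Hr.
suff [A [b [nn full]]] : exists (A : I -> 'M[R]_n) (b : J -> 'cV[R]_n),
    nonneg_real S PA PB A b /\ forall v, reach S A b v.
  exact: perturb_positive nn full.
case: (pickP (cyclic S mt)) => [x0 cx0|nc]; last first.
  by apply: acyclic_full Hm _ => x; rewrite nc.
have [x [D [cx xD Hcyc]]] := last_cycle Hr cx0.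
pose f := parent mt; pose C := orb mt x.
have [i0 _] : exists i0 : I, True.
  by case/and3P: cx => _; rewrite /state_matched; case: (mt x) => // [[i _]] _ _; exists i.
(* [i0] is a default value; on [C] every vertex is matched to a state. *)
pose mc y := if mt y is inl (i, _) then i else i0.
have cyC c : c \in C -> cyclic S mt c by rewrite inE => h; apply: (cyclic_orb Hm cx h).
have mtC c : c \in C -> mt c = inl (mc c, f c).
  move=> /cyC /and3P[_]; rewrite /state_matched /mc /f /parent.
  by case: (mt c) => // [[i y]].
have CS : C \subset S by apply/fintype.subsetP => c /cyC /and3P[].
have xC : x \in C by rewrite inE connect0.
have fC c : c \in C -> f c \in C.
  by rewrite !inE => h; apply: connect_trans h (fconnect1 _ _).
have f_orbit c c' : c \in C -> c' \in C -> exists k, iter k f c = c'.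
  move=> cC; rewrite inE => xc'; apply/iter_parentP; apply: connect_trans xc'.
  move: cC; rewrite inE; apply: cyclic_back.
  by case/and3P: cx.
have col_inj c c' : c \in C -> c' \in C -> mc c = mc c' -> f c = f c' -> c = c'.
  move=> cC c'C e1 e2; apply: (Hm.2); rewrite ?(fintype.subsetP CS) //.
  by rewrite !mtC // e1 e2.
have PAC c : c \in C -> PA (mc c) (f c) c.
  by move=> cC; have := Hm.1 c (fintype.subsetP CS c cC); rewrite mtC // => /andP[].
pose S' := S :\: C; pose PB' := contracted_PB C f mc PA PB.
(* Matched edges leaving [C] become edges from the new inputs. *)
pose mt' y : (I * 'I_n) + (J + I * 'I_n) :=
  match mt y with
  | inl (i, k) => if k \in C then inr (inr (i, k)) else inl (i, k)
  | inr j => inr (inl j) end.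
have noncyc y i l : y \in S -> y \notin C -> mt y = inl (i, l) -> ~~ cyc_col C f mc i l.
  move=> yS yC my; apply/negP => /existsP[c /and3P[cC /eqP e1 /eqP e2]].
  move: yC; rewrite (Hm.2 y c) ?cC // ?(fintype.subsetP CS) //.
  by rewrite my mtC // e1 e2.
have Hm' : matching S' PA PB' mt'.
  split=> [y|y z].
    rewrite inE => /andP[yC yS]; have := Hm.1 y yS; rewrite /mt'.
    case my: (mt y) => [[i l]|j] //; case: ifPn => lC /andP[lS p].
      by rewrite /PB' /= p lC (noncyc y).
    by rewrite inE lC lS.
  rewrite !inE => /andP[_ yS] /andP[_ zS]; rewrite /mt' => e; apply: (Hm.2) => //.
  move: e; case: (mt y) => [[i l]|j]; case: (mt z) => [[i' l']|j'] //=;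
    do ?[case: ifP => _] => //; by case=> -> // ->.
have rch_inl y : rch S' PA PB y -> rch S' PA PB' y.
  elim=> {y} [j y yS p|i l y _ IH yS p]; first exact: (@rch_in _ _ _ _ _ _ (inl j)).
  exact: rch_step IH _ p.
(* As [C] avoids [lev D], a search path of at most [D.+1] edges ending off [C] never meets [C]. *)
have lev_rch l y : y \notin C -> y \in lev S PA PB l -> (l <= D.+1)%N -> rch S' PA PB y.
  elim: l y => [|l IH] y yC /=; first by rewrite inE.
  rewrite !inE => /orP[yl|/andP[yS hy]] lD; first by apply: IH; rewrite // ltnW.
  have yS' : y \in S' by rewrite inE yC.
  case/orP: hy => [/existsP[j p]|/existsP[i /existsP[u /andP[ul p]]]].
    exact: rch_in yS' p.
  apply: (rch_step _ yS' p); apply: IH => //; last exact: ltnW.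
  apply/negP => /xD /negP; apply.
  by apply: (fintype.subsetP (lev_leq _ _ _ _)) ul.
(* Reachability passes from an iterated parent forward to [y]; where the parent lies in [C], a new
   input takes over. *)
have down q y : y \in S -> (iter q f y \in C) \/ rch S' PA PB' (iter q f y) ->
    (y \in C) \/ rch S' PA PB' y.
  elim: q y => // q IH y yS; rewrite iterSr => /(IH _ (parent_S Hm yS)).
  case: (boolP (y \in C)) => yC; first by left.
  have yS' : y \in S' by rewrite inE yC.
  move=> h; right; have := Hm.1 y yS; move: h; rewrite /f /parent.
  case my: (mt y) => [[i l]|j]; last by move=> _ p; apply: (@rch_in _ _ _ _ _ _ (inl j)).
  case=> [lC|rl] /andP[lS p]; last exact: rch_step rl yS' p.
  by apply: (@rch_in _ _ _ _ _ _ (inr (i, l))) => //=; rewrite p lC (noncyc y).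
have Hr' y : y \in S' -> rch S' PA PB' y.
  rewrite inE => /andP[yC yS]; suff [h|//] : (y \in C) \/ rch S' PA PB' y by rewrite h in yC.
  have [q] := eventually_cyclic Hm yS; set z := iter q _ y => hz.
  have zS : z \in S by apply: iter_parent_S Hm _ _ yS.
  apply: (down q) => //; rewrite -/f -/z.
  case: (boolP (z \in C)) => zC; [by left|right].
  case: hz => [|cz].
    rewrite /state_matched; have := Hm.1 z zS; case mz: (mt z) => [//|j] p _.
    by apply: (@rch_in _ _ _ _ _ _ (inl j)); rewrite // inE zC.
  (* Another cycle has a vertex within depth [D.+1], reachable off [C], and reachability then
     spreads around that cycle. *)
  have [h] := Hcyc z cz; rewrite inE => zh hD.
  have hC : h \notin C.
    apply: contra zC; rewrite !inE => xh; apply: (connect_trans xh).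
    by apply: cyclic_back zh; case/and3P: cz.
  have rh := rch_inl _ (lev_rch _ _ hC hD (leqnn _)).
  case/iter_parentP: zh => q' hq'.
  have [h'|//] : (z \in C) \/ rch S' PA PB' z; last by rewrite h' in zC.
  by apply: (down q') => //; right; rewrite /f hq'.
have cS' : (#|S'| < k)%N.
  apply: (@leq_trans #|S|); last by rewrite -ltnS.
  apply: proper_card; apply/fintype.properP; split; first exact: finset.subsetDl.
  by exists x; [apply: (fintype.subsetP CS)|rewrite inE xC].
have [A' [b' [pos full]]] := IHk S' cS' _ PB' mt' Hm' Hr'.
(* A path from an input to [x] enters [C] for the first time either directly from an input or from a
   state reached off [C]. *)
have [[j [c [cC p]]]|[i [v [c [cC rv p]]]]] :
    (exists j c, c \in C /\ PB j c) \/
    (exists i v c, [/\ c \in C, rch S' PA PB v & PA i v c]).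
  have : rch S' PA PB x \/ ((exists j c, c \in C /\ PB j c) \/
    (exists i v c, [/\ c \in C, rch S' PA PB v & PA i v c])).
    elim: (Hr x (fintype.subsetP CS x xC)) => {xC cx xD} [j y yS p|i v y _ IH yS p].
      case: (boolP (y \in C)) => yC; first by right; left; exists j, y.
      by left; apply: rch_in p; rewrite inE yC.
    case: IH => [rv|]; last by right.
    case: (boolP (y \in C)) => yC; first by right; right; exists i, v, y.
    by left; apply: rch_step rv _ p; rewrite inE yC.
  by case=> // /rch_mem; rewrite inE xC.
- exact: (@input_entry_step R n I J S C f mc PA PB CS fC f_orbit col_inj PAC A' b' pos full j c).
- exact: (@state_entry_step R n I J S C f mc PA PB CS fC f_orbit col_inj PAC A' b' pos full i v c).
Qed.

(** * The matrix exponential *)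


Section ExponentialGeneratingFunctions.
Variable R : realType.
Implicit Types (g : nat -> R) (x : R).

(** Gives convergence on the whole line by comparison with the exponential series, and is stable
    under shifts and linear combinations. *)
Definition geom_bounded g :=
  exists D K : R, [/\ 0 <= D, 0 <= K & forall l, `|g l| <= D * K ^+ l].

(** Exponential generating function: shifting the coefficients differentiates it. *)
Definition egf g x : R := limn (pseries (fun l => g l / l`!%:R) x).

Lemma is_cvg_egf g x : geom_bounded g -> cvgn (pseries (fun l => g l / l`!%:R) x).
Proof.
move=> [D [K [D0 K0 gK]]]; apply: normed_cvg.
apply: (@series_le_cvg R _ (fun l => D * exp_coeff (K * `|x|) l)).
- by move=> l; apply: normr_ge0.
- by move=> l; rewrite mulr_ge0 // /exp_coeff /= divr_ge0 ?exprn_ge0 ?mulr_ge0 ?ler0n.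
- move=> l; rewrite /exp_coeff /= !normrM normfV normr_nat normrX exprMn.
  rewrite mulrAC !mulrA ler_wpM2r ?invr_ge0 ?ler0n // ler_wpM2r ?exprn_ge0 //.
- have -> : (fun l => D * exp_coeff (K * `|x|) l) = D *: exp_coeff (K * `|x|) by [].
  exact/is_cvg_seriesZ/is_cvg_series_exp_coeff.
Qed.

Lemma geom_bounded_shift g : geom_bounded g -> geom_bounded (fun l => g l.+1).
Proof.
move=> [D [K [D0 K0 gK]]]; exists (D * K), K; split=> //; first exact: mulr_ge0.
by move=> l; rewrite (le_trans (gK _)) // exprS mulrA.
Qed.

Lemma egf_derive g x : geom_bounded g -> is_derive x 1 (egf g) (egf (fun l => g l.+1) x).
Proof.
move=> gb.
have dE (h : nat -> R) : pseries_diffs (fun l => h l / l`!%:R) = (fun l => h l.+1 / l`!%:R).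
  apply/funext => l; rewrite /pseries_diffs factS natrM invfM mulrCA; congr (_ * _).
  by rewrite mulrA mulfV ?mul1r // pnatr_eq0.
have := @pseries_snd_diffs R (fun l => g l / l`!%:R) (`|x| + 1) x.
rewrite dE dE; apply.
- exact: is_cvg_egf.
- exact: is_cvg_egf (geom_bounded_shift gb).
- exact: is_cvg_egf (geom_bounded_shift (geom_bounded_shift gb)).
- by rewrite [`| _ + _|]ger0_norm ?addr_ge0 // ltrDl.
Qed.

Lemma egf0 g : egf g 0 = g 0%N.
Proof.
apply: lim_near_cst => //; exists 1%N => // -[//|k] _.
rewrite /pseries /series /= big_nat_recl // big1 ?addr0 => [|i _].
  by rewrite fact0 invr1 expr0 !mulr1.
by rewrite exprS mul0r mulr0.
Qed.

Lemma egfZ a g x : geom_bounded g -> egf (fun l => a * g l) x = a * egf g x.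
Proof.
move=> gb; rewrite /egf /pseries.
rewrite -[RHS](@lim_seriesZ R (fun l => g l / l`!%:R * x ^+ l) a (is_cvg_egf gb)).
congr (limn (series _)); apply/funext => l.
by rewrite /GRing.scale /= -!mulrA.
Qed.

Lemma egfD g h x : geom_bounded g -> geom_bounded h ->
  egf (fun l => g l + h l) x = egf g x + egf h x.
Proof.
move=> gb hb; rewrite /egf /pseries -lim_seriesD; try exact: is_cvg_egf.
by congr (limn (series _)); apply/funext => l; rewrite /= !mulrDl.
Qed.

Lemma geom_bounded0 : geom_bounded (fun=> 0).
Proof. by exists 0, 0; split=> // l; rewrite normr0 mul0r. Qed.

Lemma geom_boundedZ a g : geom_bounded g -> geom_bounded (fun l => a * g l).
Proof.
move=> [D [K [D0 K0 gK]]]; exists (`|a| * D), K; split=> // [|l]; first exact: mulr_ge0.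
by rewrite normrM -mulrA ler_wpM2l.
Qed.

Lemma geom_boundedD g h : geom_bounded g -> geom_bounded h ->
  geom_bounded (fun l => g l + h l).
Proof.
move=> [D [K [D0 K0 gK]]] [D' [K' [D'0 K'0 hK]]].
exists (D + D'), (K + K'); split; rewrite ?addr_ge0 // => l.
rewrite (le_trans (ler_normD _ _)) // mulrDl lerD //.
  by rewrite (le_trans (gK l)) // ler_wpM2l // lerXn2r ?nnegrE ?addr_ge0 // lerDl.
by rewrite (le_trans (hK l)) // ler_wpM2l // lerXn2r ?nnegrE ?addr_ge0 // lerDr.
Qed.

Lemma egf_sum (I : Type) (r : seq I) (a : I -> R) (g : I -> nat -> R) x :
  (forall i, geom_bounded (g i)) ->
  geom_bounded (fun l => \sum_(i <- r) a i * g i l) /\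
  egf (fun l => \sum_(i <- r) a i * g i l) x = \sum_(i <- r) a i * egf (g i) x.
Proof.
move=> gb; elim: r => [|i r [IH1 IH2]].
  split; first by have -> : (fun l : nat => \sum_(i <- [::]) a i * g i l) = (fun=> 0);
    [apply/funext => l; rewrite big_nil|exact: geom_bounded0].
  rewrite big_nil /egf /pseries.
  apply: lim_near_cst => //; apply: nearW => k.
  by rewrite /series /= big1 // => j _; rewrite big_nil !mul0r.
have -> : (fun l : nat => \sum_(j <- i :: r) a j * g j l) =
    (fun l => a i * g i l + \sum_(j <- r) a j * g j l).
  by apply/funext => l; rewrite big_cons.
split; first by apply: geom_boundedD => //; apply: geom_boundedZ.
by rewrite egfD ?egfZ ?IH2 ?big_cons //; apply: geom_boundedZ.
Qed.

End ExponentialGeneratingFunctions.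

Section MatrixExponential.
Variables (R : realType) (n : nat) (A : 'M[R]_n).

Let pw (l : nat) : 'M[R]_n := iter l (mulmx A) 1%:M.

Let pwSr l : pw l.+1 = pw l *m A.
Proof.
elim: l => [|l IH]; first by rewrite /pw /= mulmx1 mul1mx.
by rewrite -[LHS]/(A *m pw l.+1) {1}IH mulmxA.
Qed.

Let pw_bounded j k : geom_bounded (fun l => pw l j k).
Proof.
(* The sum over all entries dominates every row sum, so [K ^+ l] bounds the entries of the l-th
   power. *)
pose K := \sum_a \sum_b `|A a b|.
have K0 : 0 <= K by rewrite sumr_ge0 // => a _; rewrite sumr_ge0.
exists 1, K; split=> // l; rewrite mul1r; elim: l j k => [|l IH] j k.
  by rewrite expr0 mxE; case: (j == k); rewrite ?normr1 ?normr0.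
rewrite -[pw l.+1]/(A *m pw l) mxE (le_trans (ler_norm_sum _ _ _)) // exprS.
apply: (@le_trans _ _ (\sum_b `|A j b| * K ^+ l)).
  by apply: ler_sum => b _; rewrite normrM ler_wpM2l.
rewrite -mulr_suml ler_wpM2r ?exprn_ge0 // /K [leRHS](bigD1 j) //= lerDl sumr_ge0 // => a _.
by rewrite sumr_ge0.
Qed.

Definition mexp (t : R) : 'M[R]_n := \matrix_(j, k) egf (fun l => pw l j k) t.

(* int_0^t exp(sA) ds *)
Definition mexp_int (t : R) : 'M[R]_n :=
  \matrix_(j, k) egf (fun l => if l is l'.+1 then pw l' j k else 0) t.

Let pwi_bounded j k :
  geom_bounded (fun l => if l is l'.+1 then pw l' j k else 0).
Proof.
(* The base [K + 1] is at least 1, which absorbs the index shift. *)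
have [D [K [D0 K0 gK]]] := pw_bounded j k; exists D, (K + 1).
split=> // [|[|l]]; rewrite ?addr_ge0 // ?normr0 ?mulr_ge0 ?exprn_ge0 ?addr_ge0 //.
rewrite (le_trans (gK l)) // ler_wpM2l // exprSr -[leLHS]mulr1 ler_pM ?exprn_ge0 //.
  by rewrite lerXn2r ?nnegrE ?addr_ge0 // lerDl.
by rewrite lerDr.
Qed.

Lemma mexp0 : mexp 0 = 1%:M.
Proof. by apply/matrixP => j k; rewrite mxE egf0. Qed.

Lemma mexp_int0 : mexp_int 0 = 0.
Proof. by apply/matrixP => j k; rewrite mxE egf0 mxE. Qed.

Lemma mexp_derive (t : R) j k : is_derive t 1 (fun s => mexp s j k) ((A *m mexp t) j k).
Proof.
have -> : (fun s => mexp s j k) = egf (fun l => pw l j k) by apply/funext => s; rewrite mxE.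
apply: is_derive_eq; first exact: egf_derive.
have -> : (fun l => pw l.+1 j k) = (fun l => \sum_m A j m * pw l m k).
  by apply/funext => l; rewrite mxE.
rewrite (egf_sum _ _ _ (fun m => pw_bounded m k)).2 mxE.
by apply: eq_bigr => m _; rewrite mxE.
Qed.

Lemma mexp_comm t : A *m mexp t = mexp t *m A.
Proof.
apply/matrixP => j k; rewrite !mxE.
transitivity (egf (fun l => pw l.+1 j k) t).
  have -> : (fun l => pw l.+1 j k) = (fun l => \sum_m A j m * pw l m k).
    by apply/funext => l; rewrite mxE.
  rewrite (egf_sum _ _ _ (fun m => pw_bounded m k)).2.
  by apply: eq_bigr => m _; rewrite mxE.
have -> : (fun l => pw l.+1 j k) = (fun l => \sum_m A m k * pw l j m).
  by apply/funext => l; rewrite pwSr mxE; apply: eq_bigr => m _; rewrite mulrC.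
rewrite (egf_sum _ _ _ (fun m => pw_bounded j m)).2.
by apply: eq_bigr => m _; rewrite mxE mulrC.
Qed.

Lemma mexp_int_derive (t : R) j k : is_derive t 1 (fun s => mexp_int s j k) (mexp t j k).
Proof.
have -> : (fun s => mexp_int s j k) =
    egf (fun l => if l is l'.+1 then pw l' j k else 0) by apply/funext => s; rewrite mxE.
by apply: is_derive_eq; [exact: egf_derive (pwi_bounded j k)|rewrite mxE].
Qed.

End MatrixExponential.

(** * Entrywise derivatives of matrix products *)

Section MatrixDerivatives.
Variable R : realType.

Lemma is_derive_sum_fun n (h : 'I_n -> R -> R) (dh : 'I_n -> R) (t : R) :
  (forall i, is_derive t 1 (h i) (dh i)) ->
  is_derive t 1 (fun s => \sum_(i < n) h i s) (\sum_(i < n) dh i).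
Proof.
move=> H; have -> : (fun s => \sum_(i < n) h i s) = \sum_(i < n) h i.
  by apply/funext => s; rewrite fct_sumE.
exact: is_derive_sum.
Qed.

Lemma is_derive_mulmx m n p (M : R -> 'M[R]_(m, n)) (P : R -> 'M[R]_(n, p))
    (dM : 'M[R]_(m, n)) (dP : 'M[R]_(n, p)) (t : R) j k :
  (forall j k, is_derive t 1 (fun s => M s j k) (dM j k)) ->
  (forall j k, is_derive t 1 (fun s => P s j k) (dP j k)) ->
  is_derive t 1 (fun s => (M s *m P s) j k) ((dM *m P t + M t *m dP) j k).
Proof.
move=> HM HP.
have -> : (fun s => (M s *m P s) j k) = (fun s => \sum_i (M s j i * P s i k)).
  by apply/funext => s; rewrite mxE.
rewrite mxE [X in X + _]mxE [X in _ + X]mxE -big_split /=.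
apply: is_derive_sum_fun => i.
have := @is_deriveM R R (fun s => M s j i) (fun s => P s i k) t 1 _ _ (HM j i) (HP i k).
by move=> h; apply: is_derive_eq; rewrite /GRing.scale /= addrC mulrC [X in _ + X]mulrC; congr (_ + _); rewrite mulrC.
Qed.

Lemma is_derive_cst_mx m n (M : 'M[R]_(m, n)) (t : R) j k :
  is_derive t 1 (fun s : R => M j k) ((0 : 'M[R]_(m, n)) j k).
Proof. by rewrite mxE; apply: is_derive_cst. Qed.

End MatrixDerivatives.

(** The difference [mexp A t - A *m mexp_int A t] has derivative 0 and equals the identity at 0. *)
Lemma mexp_intE (R : realType) n (A : 'M[R]_n) t : mexp A t = 1%:M + A *m mexp_int A t.
Proof.
apply/matrixP => j k; rewrite [RHS]mxE; apply/eqP; rewrite -subr_eq; apply/eqP.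
transitivity (mexp A 0 j k - (A *m mexp_int A 0) j k); last first.
  by rewrite mexp0 mexp_int0 mulmx0 [X in _ - X]mxE subr0.
apply: (@is_derive_0_is_cst R (fun s => mexp A s j k - (A *m mexp_int A s) j k)) => {}t.
have h1 := mexp_derive A t j k.
have h2 := @is_derive_mulmx R _ _ _ (fun=> A) (mexp_int A) 0 (mexp A t) t j k
  (is_derive_cst_mx A t) (mexp_int_derive A t).
have := is_deriveB h1 h2; rewrite mul0mx add0r subrr.
by [].
Qed.

(** * Trajectories *)

Lemma partition_leq (R : realType) (p : nat -> R) K tf l l' :
  Defs.partition p K tf -> (l <= l')%N -> (l' <= K)%N -> p l <= p l'.
Proof.
move=> [_ _ pl]; elim: l' => [|l' IH]; first by rewrite leqn0 => /eqP->.
rewrite leq_eqVlt => /orP[/eqP-> //|ll'] l'K.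
by rewrite (le_trans (IH _ (ltnW l'K))) // ltW // pl.
Qed.

Lemma continuous_is_derive (R : realType) (f : R -> R) (df : R -> R) :
  (forall t : R, is_derive t 1 f (df t)) -> continuous f.
Proof.
move=> H t; apply: differentiable_continuous; apply/derivable1_diffP.
by case: (H t).
Qed.

Lemma within_continuous_eq (R : realType) (D : set R) (f g : R -> R) :
  (forall t, D t -> f t = g t) ->
  {within D, continuous f}%classic -> {within D, continuous g}%classic.
Proof. by move=> e; apply: subspace_eq_continuous => t; rewrite inE => /e. Qed.

Section Trajectories.
Variables (R : realType) (n N : nat) (m : 'I_N -> nat).
Variables (Ar : 'I_N -> 'M[R]_n) (Br : forall i : 'I_N, 'M[R]_(n, m i)).

(** [controllable_state] with an arbitrary target, so that trajectories can be extended piece by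
    piece. *)
Definition steers (x0 x1 : 'cV[R]_n) : Prop :=
  exists (tf : R) (K : nat) (p : nat -> R),
    Defs.partition p K tf /\
  exists (sigma : R -> 'I_N) (u : forall i : 'I_N, R -> 'cV[R]_(m i))
         (x : R -> 'cV[R]_n),
    [/\
        (forall l, (l < K)%N -> exists i, forall t, p l <= t < p l.+1 -> sigma t = i),
        (forall l, (l < K)%N -> forall (i : 'I_N) (c : 'I_(m i)),
           exists g : R -> R, continuous g /\
             forall t, p l < t < p l.+1 -> u i t c 0 = g t),
        x 0 = x0 /\ x tf = x1,
        (forall j : 'I_n, {within [set t : R | 0 <= t <= tf]%classic,
                            continuous (fun t => x t j 0)}%classic) &
        (forall l, (l < K)%N -> forall t, p l < t < p l.+1 -> forall j : 'I_n,
           is_derive t 1 (fun s => x s j 0)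
             ((Ar (sigma t) *m x t + Br (sigma t) *m u (sigma t) t) j 0))].

Lemma steers_refl (i0 : 'I_N) x0 : steers x0 x0.
Proof.
exists 0, 0%N, (fun=> 0); split; first by [].
exists (fun=> i0), (fun=> fun=> 0), (fun=> x0); split=> // j.
by apply: continuous_subspaceT => t; apply: cvg_cst.
Qed.

(** Variation of constants for mode [i] under the constant input [v]. *)
Definition flow i (v : 'cV[R]_(m i)) (x1 : 'cV[R]_n) (s : R) : 'cV[R]_n :=
  mexp (Ar i) s *m x1 + mexp_int (Ar i) s *m (Br i *m v).

Lemma flow0 i (v : 'cV[R]_(m i)) x1 : flow v x1 0 = x1.
Proof. by rewrite /flow mexp0 mexp_int0 mul1mx mul0mx addr0. Qed.

Lemma flow_derive i (v : 'cV[R]_(m i)) x1 (s : R) j :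
  is_derive s 1 (fun s => flow v x1 s j 0) ((Ar i *m flow v x1 s + Br i *m v) j 0).
Proof.
have h1 := @is_derive_mulmx R _ _ _ (mexp (Ar i)) (fun=> x1) _ _ s j 0
  (mexp_derive (Ar i) s) (is_derive_cst_mx x1 s).
have h2 := @is_derive_mulmx R _ _ _ (mexp_int (Ar i)) (fun=> Br i *m v) _ _ s j 0
  (mexp_int_derive (Ar i) s) (is_derive_cst_mx (Br i *m v) s).
have -> : (fun s => flow v x1 s j 0) = (fun s => (mexp (Ar i) s *m x1) j 0) +
    (fun s => (mexp_int (Ar i) s *m (Br i *m v)) j 0).
  by apply/funext => t; rewrite mxE.
apply: is_derive_eq (is_deriveD h1 h2) _.
rewrite !mulmx0 !addr0 /flow mulmxDr -addrA [RHS]mxE; congr (_ + _); first by rewrite mulmxA.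
by rewrite {1}mexp_intE mulmxDl mul1mx addrC -mulmxA.
Qed.

Lemma steers_step x0 x1 i (v : 'cV[R]_(m i)) (h : R) : 0 < h -> steers x0 x1 ->
  steers x0 (flow v x1 h).
Proof.
move=> h0 [tf [K [p [hp [sigma [u [x [Hs Hu [x0E x1E] Hc Hd]]]]]]]].
have [p0 pK plt] := hp.
have tf0 : 0 <= tf by rewrite -p0 -pK; apply: partition_leq hp _ _.
pose p' l := if (l <= K)%N then p l else tf + h.
(* The input family over all modes: [v] in mode [i], zero in the others. *)
pose V := @dfwith 'I_N (fun i => 'cV[R]_(m i)) (fun=> 0) i v.
have pl l t : (l < K)%N -> t < p l.+1 -> t < tf.
  by move=> lK /lt_le_trans; apply; rewrite -pK; apply: partition_leq hp _ _.
pose x' t := if t <= tf then x t else flow v x1 (t - tf).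
exists (tf + h), K.+1, p'; split.
  split; rewrite /p' ?ltnn ?leq0n // => l lK; rewrite (lK : (l <= K)%N).
  move: lK; rewrite ltnS leq_eqVlt => /orP[/eqP->|lK]; last by rewrite lK; apply: plt.
  by rewrite ltnn pK ltrDl.
exists (fun t => if t < tf then sigma t else i),
  (fun i' t => if t < tf then u i' t else V i'), x'; split.
- move=> l; rewrite ltnS leq_eqVlt /p' => /orP[/eqP->|lK].
    exists i => t; rewrite leqnn ltnn pK => /andP[tft _].
    by rewrite ltNge tft.
  have [i' Hi'] := Hs l lK; exists i' => t; rewrite (ltnW lK) lK => ht.
  by rewrite (pl l) ?Hi' //; case/andP: ht.
- move=> l; rewrite ltnS leq_eqVlt /p' => /orP[/eqP->|lK] i' c.
    exists (fun=> V i' c 0); split; first by move=> t; apply: cvg_cst.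
    by move=> t; rewrite leqnn ltnn pK => /andP[/ltW tft _]; rewrite ltNge tft.
  have [g [gc Hg]] := Hu l lK i' c; exists g; split=> // t; rewrite (ltnW lK) lK => ht.
  by rewrite (pl l) ?Hg //; case/andP: ht.
- split; first by rewrite /x' tf0.
  by rewrite /x' leNgt ltrDl h0 /= addrC addKr.
- move=> j.
  have -> : [set t : R | 0 <= t <= tf + h]%classic =
      (`[0%R, tf] `|` `[tf, tf + h])%classic.
    apply/seteqP; split=> t /=; rewrite !in_itv /=.
      by move=> /andP[-> th]; case: (leP t tf) => h1; [left|right; rewrite ltW].
    case=> /andP[h1 h2]; first by rewrite h1 (le_trans h2) // lerDl ltW.
    by rewrite (le_trans tf0).
  apply: withinU_continuous; try exact: interval_closed.
    apply: (@within_continuous_eq _ _ (fun t => x t j 0)).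
      by move=> t; rewrite /= in_itv /= => /andP[_ tl]; rewrite /x' tl.
    apply: continuous_subspaceW (Hc j).
    by move=> t /=; rewrite in_itv.
  apply: (@within_continuous_eq _ _ (fun t => flow v x1 (t - tf) j 0)).
    move=> t; rewrite /= in_itv /= => /andP[tl _]; rewrite /x'.
    case: (leP t tf) => // tl'; have -> : t = tf by apply/le_anti; rewrite tl' tl.
    by rewrite subrr flow0 x1E.
  apply: continuous_subspaceT => t.
  apply: (@continuous_comp _ _ _ (fun s : R => s - tf) (fun s : R => flow v x1 s j 0)).
    by apply: cvgB; [exact: cvg_id|exact: cvg_cst].
  exact: (continuous_is_derive (fun s => flow_derive v x1 s j)).
- move=> l; rewrite ltnS leq_eqVlt /p' => /orP[/eqP->|lK] t.
    rewrite leqnn ltnn pK => /andP[tft _] j.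
    rewrite ltNge (ltW tft) /= /V dfwithin {2}/x' leNgt tft /=.
    apply: (@near_eq_is_derive _ _ _ (fun s => flow v x1 (s - tf) j 0)).
      near=> s; rewrite /x' leNgt (_ : tf < s) //.
      by near: s; apply: lt_nbhsr.
    have d1 : is_derive t (1 : R) (fun s : R => s - tf) 1.
      by apply: is_derive_eq; rewrite ?subr0.
    have := @is_derive1_comp R (fun s => flow v x1 s j 0) (fun s => s - tf) t _ _
      (flow_derive v x1 (t - tf) j) d1.
    by rewrite mulr1.
  rewrite (ltnW lK) lK => ht j; have ttf : t < tf by apply: (pl l) => //; case/andP: ht.
  rewrite ttf {2}/x' (ltW ttf).
  apply: (@near_eq_is_derive _ _ _ (fun s => x s j 0)); last exact: Hd lK _ ht j.
  near=> s; rewrite /x' ltW //.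
  by near: s; apply: lt_nbhsl.
Unshelve. all: by end_near.
Qed.

End Trajectories.

(** * Controllability and the reachable space *)

(** The derivative is also the limit of the right difference quotients, and those are all 0. *)
Lemma derive_zero_right (R : realType) (f : R -> R) d :
  is_derive (0 : R) 1 f d -> (forall h, 0 <= h -> f h = 0) -> d = 0.
Proof.
move=> [df <-] f0.
have h1 : (h^-1 *: (f (h *: 1 + 0) - f 0) @[h --> 0^'+] --> 'D_1 f 0)%classic.
  exact: (cvg_dnbhs_at_right df).
have h2 : (h^-1 *: (f (h *: 1 + 0) - f 0) @[h --> 0^'+] --> (0 : R))%classic.
  apply: (@cvg_trans _ ((fun=> (0 : R)) x @[x --> 0^'+])%classic); last exact: cvg_cst.
  apply: near_eq_cvg; near=> h.
  by rewrite !f0 // ?subrr ?scaler0 // addr0 [_ *: _]mulr1.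
exact: (cvg_unique _ h1 h2).
Unshelve. all: by end_near.
Qed.

Section Controllability.
Variables (R : realType) (n N : nat) (m : 'I_N -> nat).
Variables (Ar : 'I_N -> 'M[R]_n) (Br : forall i : 'I_N, 'M[R]_(n, m i)).

Implicit Type s : seq ('I_N * R).

(* Switching sequences are listed with the last mode first; a pair is a mode
   together with its dwell time. *)
Definition valid s := all (fun p => 0 < p.2) s.

(** The motion without input along the whole sequence. *)
Fixpoint transfer s : 'M[R]_n :=
  if s is (i, h) :: s' then mexp (Ar i) h *m transfer s' else 1%:M.

(* The rows span the states reachable from 0 with piecewise constant inputs. *)
Fixpoint from0 s : 'M[R]_n :=
  if s is (i, h) :: s' then
    (from0 s' *m (mexp (Ar i) h)^T + (mexp_int (Ar i) h *m Br i)^T)%MS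
  else 0.

Lemma steers_from0 (i0 : 'I_N) s (y : 'cV[R]_n) : valid s -> (y^T <= from0 s)%MS ->
  forall x0, steers Ar Br x0 (transfer s *m x0 + y).
Proof.
elim: s y => [|[i h] s IH] y /=.
  move=> _; rewrite submx0 => /eqP y0 x0.
  by rewrite mul1mx -[y]trmxK y0 trmx0 addr0; apply: steers_refl.
move=> /andP[h0 vs] /sub_addsmxP[[a b] /= yE] x0.
have y1 : ((from0 s)^T *m a^T)^T = a *m from0 s by rewrite trmx_mul !trmxK.
have := IH ((from0 s)^T *m a^T) vs; rewrite y1 => /(_ (submxMl _ _) x0).
move=> /(steers_step b^T h0); rewrite /flow mulmxDr -mulmxA -addrA.
rewrite (_ : y = mexp (Ar i) h *m ((from0 s)^T *m a^T) + mexp_int (Ar i) h *m (Br i *m b^T)) //.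
by rewrite -[y]trmxK yE linearD /= !trmx_mul !trmxK !mulmxA.
Qed.

Lemma from0_catl s s' : (from0 s <= from0 (s ++ s'))%MS.
Proof.
elim: s => [|[i h] s IH] /=; first exact: sub0mx.
by apply: addsmxS => //; apply: submxMr.
Qed.

Lemma from0_catr s s' : (from0 s' *m (transfer s)^T <= from0 (s ++ s'))%MS.
Proof.
elim: s => [|[i h] s IH] /=; first by rewrite trmx1 mulmx1.
rewrite trmx_mul mulmxA; apply: submx_trans (addsmxSl _ _).
exact: submxMr.
Qed.

(** Take [from0 s] of maximal rank. It is contained in [from0 (s ++ s')], hence equal to it as a
    space, and the latter contains the image of [from0 s'] under [transfer s]. *)
Lemma max_from0 : exists2 s, valid s &
  forall s', valid s' -> (from0 s' *m (transfer s)^T <= from0 s)%MS.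
Proof.
pose P r := `[< exists2 s, valid s & \rank (from0 s) = r >].
have exP : exists r, P r by exists (\rank (from0 [::])); apply/asboolP; exists [::].
have leP r : P r -> (r <= n)%N by move=> /asboolP[s _ <-]; apply: rank_leq_row.
case: (ex_maxnP exP leP) => r /asboolP[s vs rs] maxr; exists s => // s' vs'.
apply: submx_trans (from0_catr s s') _.
rewrite -(geq_leqif (mxrank_leqif_sup (from0_catl s s'))) rs; apply: maxr.
by apply/asboolP; exists (s ++ s') => //; rewrite /valid all_cat; apply/andP.
Qed.

Definition input_col (j : {i : 'I_N & 'I_(m i)}) : 'cV[R]_n :=
  col (tagged j) (Br (tag j)).

Local Notation rc := (reach [set: 'I_n] Ar input_col).

Lemma derive_pairing_zero (M : R -> 'M[R]_n) (D : 'M[R]_n) (v w q : 'cV[R]_n) :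
  (forall j k, is_derive (0 : R) 1 (fun t => M t j k) (D j k)) -> D *m v = w ->
  (forall h, 0 <= h -> (M h *m v)^T *m q = 0) -> w^T *m q = 0.
Proof.
move=> dM <- M0; apply/matrixP => a b; rewrite !ord1 [RHS]mxE.
apply: (@derive_zero_right R (fun h => ((M h *m v)^T *m q) 0 0)); last first.
  by move=> h /M0 ->; rewrite mxE.
have d1 j k := @is_derive_mulmx R _ _ _ M (fun=> v) D 0 0 j k dM (is_derive_cst_mx v 0).
have := @is_derive_mulmx R _ _ _ (fun t => (M t *m v)^T) (fun=> q) (D *m v)^T 0 0 0 0 _
  (is_derive_cst_mx q 0).
rewrite mulmx0 addr0; apply=> j k.
have -> : (fun t => (M t *m v)^T j k) = (fun t => (M t *m v) k j).
  by apply/funext => t; rewrite mxE.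
by rewrite [X in is_derive _ _ _ X]mxE; have := d1 k j; rewrite mulmx0 addr0.
Qed.

(* Differentiating at dwell time 0 recovers the generators of the
   reachable space. *)
Lemma annihilator_reach x : rc x ->
  forall q : 'cV[R]_n, (forall s, valid s -> from0 s *m q = 0) -> x^T *m q = 0.
Proof.
elim=> {x} [x|[i k]|i v _ IH|c v w _ IHv _ IHw|].
- by rewrite inE.
- move=> q Hq; apply: (@derive_pairing_zero (mexp_int (Ar i)) (mexp (Ar i) 0)).
  + exact: mexp_int_derive.
  + by rewrite mexp0 mul1mx.
  + move=> h; rewrite le_eqVlt => /orP[/eqP<-|h0].
      by rewrite mexp_int0 mul0mx trmx0 mul0mx.
    have : ((mexp_int (Ar i) h *m input_col (Tagged _ k))^T <= from0 [:: (i, h)])%MS.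
      rewrite /input_col /= colE mulmxA trmx_mul.
      exact: submx_trans (submxMl _ _) (addsmxSr _ _).
    by case/submxP => D ->; rewrite -mulmxA Hq ?mulmx0 //= h0.
- move=> q Hq; apply: (@derive_pairing_zero (mexp (Ar i)) (Ar i *m mexp (Ar i) 0) v).
  + exact: mexp_derive.
  + by rewrite mexp0 mulmx1.
  + move=> h; rewrite le_eqVlt => /orP[/eqP<-|h0]; first by rewrite mexp0 mul1mx IH.
    (* The induction hypothesis is used for [q] multiplied by the transposed exponential: a sequence
       [s] tested against it is the sequence with (i, h) added, tested against [q]. *)
    rewrite trmx_mul -mulmxA; apply: IH => s vs; rewrite mulmxA.
    have := Hq ((i, h) :: s); rewrite /= h0 => /(_ vs) H.
    have /submxP[D ->] : (from0 s *m (mexp (Ar i) h)^T <= from0 ((i, h) :: s))%MS.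
      exact: addsmxSl.
    by rewrite -mulmxA H mulmx0.
- move=> q Hq.
  by rewrite linearD linearZ /= mulmxDl -scalemxAl IHv // IHw // scaler0 addr0.
- by move=> q _; rewrite trmx0 mul0mx.
Qed.

Theorem reach_controllable (i0 : 'I_N) : (forall x, rc x) -> controllable Ar Br.
Proof.
move=> full x0; have [s vs maxs] := max_from0.
have ann0 (q : 'cV[R]_n) : (forall s, valid s -> from0 s *m q = 0) -> q = 0.
  move=> Hq; apply/matrixP => a b; rewrite ord1.
  have /matrixP/(_ 0 0) := annihilator_reach (full (delta_mx a 0)) Hq.
  by rewrite trmx_delta -rowE !mxE.
(* By maximality every [from0 s'] annihilates the columns of [(transfer s)^T *m cokermx (from0 s)],
   which therefore vanish. *)
have sub : ((transfer s)^T <= from0 s)%MS.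
  rewrite submxE; apply/eqP/matrixP => a b.
  have /matrixP/(_ a 0) : col b ((transfer s)^T *m cokermx (from0 s)) = 0.
    apply: ann0 => s' vs'; rewrite colE mulmxA mulmxA.
    have /submxP[D ->] := maxs s' vs'.
    by rewrite -(mulmxA D) mulmx_coker mulmx0 mul0mx.
  by rewrite !mxE.
(* The free motion of [x0] is cancelled by a vector reachable from 0 along the same sequence. *)
have : steers Ar Br x0 (transfer s *m x0 + - (transfer s *m x0)).
  apply: steers_from0 => //; rewrite linearN /= eqmx_opp trmx_mul.
  by apply: submx_trans sub; apply: submxMl.
by rewrite subrr.
Qed.

End Controllability.

Lemma continuous_sum_fun (R : realType) (T : topologicalType) n (f : 'I_n -> T -> R) :
  (forall i, continuous (f i)) -> continuous (fun t => \sum_(i < n) f i t).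
Proof. by move=> cf; apply: continuous_big => //; exact: add_continuous. Qed.

Lemma within_continuous_mulmx (R : realType) (D : set R) p q (M : R -> 'M[R]_(p, q))
    (y : R -> 'cV[R]_q) j :
  (forall j k, {within D, continuous (fun t => M t j k)}%classic) ->
  (forall k, {within D, continuous (fun t => y t k 0)}%classic) ->
  {within D, continuous (fun t => (M t *m y t) j 0)}%classic.
Proof.
move=> cM cy.
apply: (@within_continuous_eq _ _ (fun t => \sum_k M t j k * y t k 0)).
  by move=> t _; rewrite mxE.
apply: (@continuous_sum_fun R (subspace D) q (fun k t => M t j k * y t k 0)) => k t.
exact: (@continuousM R (subspace D) (fun t => M t j k) (fun t => y t k 0) t (cM j k t) (cy k t)).
Qed.

(* Along a trajectory, [y = Q x] solves the autonomous system [y' = M_sigma y],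
   so it cannot reach 0 unless it starts there. *)
Theorem controllable_annihilator (R : realType) (n N : nat) (m : 'I_N -> nat)
    (Ar : 'I_N -> 'M[R]_n) (Br : forall i : 'I_N, 'M[R]_(n, m i)) r
    (Q : 'M[R]_(r, n)) (M : 'I_N -> 'M[R]_r) :
  (forall i, Q *m Ar i = M i *m Q) -> (forall i, Q *m Br i = 0) ->
  controllable Ar Br -> Q = 0.
Proof.
move=> QA QB ctrl.
suff Qx (x0 : 'cV[R]_n) : Q *m x0 = 0.
  by apply/matrixP => a b; have /matrixP/(_ a 0) := Qx (delta_mx b 0); rewrite -colE !mxE.
have [tf [K [p [hp [sigma [u [x [Hs Hu [x0E x1E] Hc Hd]]]]]]]] := ctrl x0.
have [p0 pK plt] := hp.
(* Backward induction over the pieces, starting from the final state 0. *)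
suff H l : (l <= K)%N -> Q *m x (p (K - l)%N) = 0.
  by have := H K (leqnn K); rewrite subnn p0 x0E.
elim: l => [_|l IH lK]; first by rewrite subn0 pK x1E mulmx0.
have {IH} := IH (ltnW lK); set k := (K - l.+1)%N.
have -> : (K - l)%N = k.+1 by rewrite /k subnS prednK // subn_gt0.
have kK : (k < K)%N by rewrite /k ltn_subrL (leq_trans _ lK).
set a := p k; set b := p k.+1 => yb.
have ab : a < b by apply: plt.
have [i Hi] := Hs k kK.
(* An integrating factor: [z] is constant on the piece. *)
pose z s := mexp (M i) (a - s) *m (Q *m x s).
have za : z a = Q *m x a by rewrite /z subrr mexp0 mul1mx.
have zb : z b = 0 by rewrite /z yb mulmx0.
rewrite -za -zb; apply/matrixP => j c; rewrite ord1; apply/eqP; rewrite eq_sym -subr_eq0; apply/eqP.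
have dexp (t : R) (d e : 'I_r) : is_derive t 1 (fun s => mexp (M i) (a - s) d e)
    ((- (M i *m mexp (M i) (a - t))) d e).
  have d1 : is_derive t (1 : R) (fun s : R => a - s) (-1).
    by have := is_deriveB (is_derive_cst a t 1) (is_derive_id t (1 : R)); rewrite sub0r.
  have := @is_derive1_comp R (fun s => mexp (M i) s d e) (fun s => a - s) t _ _
    (mexp_derive (M i) (a - t) d e) d1.
  by rewrite mulrN1 => h; rewrite [X in is_derive _ _ _ X]mxE.
have dz (t : R) : t \in `]a, b[%R -> is_derive t 1 (fun s => z s j 0) ((fun=> 0) t).
  rewrite in_itv /= => tab.
  have st : sigma t = i by apply: Hi; case/andP: tab => /ltW -> ->.
  have dx : forall (d : 'I_n) (e : 'I_1), is_derive t 1 (fun s => x s d e)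
      ((Ar i *m x t + Br i *m u i t) d e).
    by move=> d e; rewrite ord1; have := Hd k kK t tab d; rewrite st.
  have dy d e := @is_derive_mulmx R _ _ _ (fun=> Q) x 0 _ t d e (is_derive_cst_mx Q t) dx.
  have := @is_derive_mulmx R _ _ _ (fun s => mexp (M i) (a - s)) (fun s => Q *m x s)
    _ _ t j 0 (dexp t) dy.
  rewrite mul0mx add0r mulmxDr (mulmxA Q (Ar i)) QA (mulmxA Q (Br i)) QB mul0mx addr0.
  by rewrite mexp_comm mulNmx -!mulmxA addNr mxE.
have cz : {within `[a, b]%classic, continuous (fun s => z s j 0)}%classic.
  apply: within_continuous_mulmx => [d e|d].
    apply: continuous_subspaceT.
    exact: (continuous_is_derive (fun t => dexp t d e)).
  apply: within_continuous_mulmx => [d' e|e].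
    by apply: continuous_subspaceT => t; apply: cvg_cst.
  apply: continuous_subspaceW (Hc e) => t /=; rewrite in_itv /= => /andP[h1 h2].
  rewrite (le_trans _ h1) ?(le_trans h2) //.
    by rewrite -pK; apply: partition_leq hp _ _.
  by rewrite -p0; apply: partition_leq hp _ (ltnW kK).
by have [c' _ ->] := MVT ab dz cz; rewrite mul0r.
Qed.

(** * Matchings of the colored union graph *)

(** Some n columns form an invertible minor, and a nonzero term of its Leibniz expansion selects a
    nonzero entry in each row, in distinct columns. *)
Lemma full_rank_transversal (F : fieldType) n p (M : 'M[F]_(n, p)) : \rank M = n ->
  exists2 g : 'I_n -> 'I_p, injective g & forall j, M j (g j) != 0.
Proof.
move=> rM.
have fM : row_full M^T by rewrite /row_full mxrank_tr rM.
have uM := fullrowsub_unit fM; set f := fullrankfun fM in uM.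
have f_inj : injective f.
  move=> i j; rewrite !ffunE /= => /maxrankfun_inj /cast_ord_inj //.
rewrite unitmxE unitfE /determinant in uM.
have [s Hs] : exists s : 'S_n, \prod_i rowsub f M^T i (s i) != 0.
  apply: contrapT => H; move/eqP: uM; apply; apply: big1 => s _.
  apply/eqP; rewrite mulf_eq0 signr_eq0 /=; apply: contraT => h.
  by case: H; exists s.
exists (fun j => f ((s^-1)%g j)) => [i j /f_inj /perm_inj //|j].
move/prodf_neq0: Hs => /(_ ((s^-1)%g j) isT).
by rewrite !mxE permKV.
Qed.

Section GraphMatching.
Variables (n N : nat) (m : 'I_N -> nat).
Variables (A : 'I_N -> 'M[bool]_n) (B : forall i : 'I_N, 'M[bool]_(n, m i)).

Definition edge_matching (mt : 'I_n -> edge n m) :=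
  [/\ forall j, is_edge A B (mt j), forall j, ehead (mt j) = j &
      forall j j', etail (mt j) = etail (mt j') ->
        ecolor (mt j) = ecolor (mt j') -> j = j'].

Definition pA i k j := A i j k.
Definition pB (u : {i : 'I_N & 'I_(m i)}) j := B (tag u) j (tagged u).

Definition edge_col (e : edge n m) : ('I_N * 'I_n) + {i : 'I_N & 'I_(m i)} :=
  match e with SE i k _ => inl (i, k) | IE i k _ => inr (Tagged _ k) end.

Lemma edge_col_inj e e' : edge_col e = edge_col e' ->
  etail e = etail e' /\ ecolor e = ecolor e'.
Proof.
case: e => [i k j|i k j]; case: e' => [i' k' j'|i' k' j'] //=; first by case=> -> ->.
move=> h; have {h} h : Tagged (fun i => 'I_(m i)) k = Tagged (fun i => 'I_(m i)) k' by case: h.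
split; last exact: (congr1 tag h).
exact: (congr1 (fun u : {i : 'I_N & 'I_(m i)} => @VU n N m (tag u) (tagged u)) h).
Qed.

Section Fixed.
Variable mt : 'I_n -> edge n m.
Hypothesis Hmt : edge_matching mt.

Definition col_matching j := edge_col (mt j).

Lemma col_matchingP : matching [set: 'I_n] pA pB col_matching.
Proof.
case: Hmt => h1 h2 h3; split=> [x _|x y _ _]; rewrite /col_matching.
  by have := h1 x; have := h2 x; case: (mt x) => [i k j|i k j] /= -> H; rewrite /pA /pB ?inE.
by move=> /edge_col_inj[t c]; apply: h3.
Qed.

Local Notation par := (parent col_matching).

Lemma tail_state j : state_matched col_matching j -> etail (mt j) = VX m (par j).
Proof. by rewrite /state_matched /parent /col_matching; case: (mt j). Qed.

Lemma tail_input j : ~~ state_matched col_matching j ->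
  exists (i : 'I_N) (k : 'I_(m i)), etail (mt j) = VU n k.
Proof. by rewrite /state_matched /col_matching; case: (mt j) => // i k j' _; exists i, k. Qed.

Lemma tail_state_matched j k : etail (mt j) = VX m k ->
  state_matched col_matching j /\ par j = k.
Proof. by rewrite /state_matched /parent /col_matching; case: (mt j) => //= i k' j' [->]. Qed.

Lemma mt_head j : ehead (mt j) = j. Proof. by case: Hmt. Qed.

(** [parent] runs against the edges, so the cycle lists the iterates backwards. With [L] the least
    period, equal tails at [l1 < l2] would give the smaller period [l1 + (L - l2)]. *)
Lemma matching_cycle x (Es : edge n m -> Prop) : cyclic [set: 'I_n] col_matching x ->
  (forall y, fconnect par x y -> Es (mt y)) -> exists L c, is_cycle Es L c.
Proof.
move=> cx HEs; have /and3P[_ _ /iter_parentP[p]] := cx; rewrite -iterSr => hp.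
have ex : exists L, (0 < L)%N && (iter L par x == x) by exists p.+1; apply/eqP.
case: (ex_minnP ex) => L /andP[L0 /eqP hL] minL.
have sm k : state_matched col_matching (iter k par x).
  by case/and3P: (cyclic_orb col_matchingP cx (fconnect_iter par k x)).
have tl l : (l < L)%N -> etail (mt (iter (L - l.+1) par x)) = VX m (iter (L - l) par x).
  by move=> lL; rewrite tail_state // -iterS subnS prednK ?subn_gt0.
exists L, (fun l => mt (iter (L - l.+1) par x)); split=> //.
- by move=> l _; apply: HEs; apply: fconnect_iter.
- move=> l lL; rewrite mt_head tl ?ltn_mod //.
  move: lL; rewrite leq_eqVlt => /orP[/eqP lL|lL]; last by rewrite modn_small.
  by rewrite lL modnn subn0 hL subnn.
- move=> l1 l2 h1 h2; rewrite !tl // => -[].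
  wlog lt12 : l1 l2 h1 h2 / (l1 < l2)%N.
    move=> W e; case: (ltngtP l1 l2) => // h; first exact: (W l1 l2).
    by apply/esym; apply: (W l2 l1).
  move=> e; have := congr1 (iter l1 par) e; rewrite -!iterD subnKC ?(ltnW h1) // hL => e'.
  have : (L <= l1 + (L - l2))%N.
    by apply: minL; rewrite -e' eqxx andbT addn_gt0 subn_gt0 h2 orbT.
  by rewrite leqNgt -[X in (_ < X)%N](subnKC (ltnW h2)) ltn_add2r lt12.
Qed.

(** Conversely, on a cycle of matched edges [parent] moves to the preceding head; adding [L.-1]
    modulo [L] is the cyclic predecessor. *)
Lemma cycle_head Es L c : (forall e, Es e -> e = mt (ehead e)) -> is_cycle Es L c ->
  forall l, (l < L)%N -> state_matched col_matching (ehead (c l)) /\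
    par (ehead (c l)) = ehead (c ((l + L.-1) %% L)%N).
Proof.
move=> HEs [L0 cE ct _] l lL; pose l' := ((l + L.-1) %% L)%N.
have l'L : (l' < L)%N by rewrite ltn_mod.
have := ct l' l'L; have -> : (l'.+1 %% L)%N = l.
  by rewrite -addn1 modnDml -addnA addn1 prednK // modnDr modn_small.
rewrite (HEs _ (cE l lL)) => /esym/tail_state_matched[h1 h2].
by rewrite mt_head.
Qed.

End Fixed.

Lemma input_reachable_rch j : input_reachable A B j -> rch [set: 'I_n] pA pB j.
Proof.
move=> [i [k h]].
pose P (v : vtx n m) := if v is VX j then rch [set: 'I_n] pA pB j else True.
suff step v w : clos_trans _ (adj A B) v w -> P v -> P w by apply: (step _ _ h).
elim=> {v w} [v w [e [ie [<- <-]]]|v w z _ IH1 _ IH2 /IH1/IH2 //].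
case: e ie => [i' k' j'|i' k' j'] /= ie; first by move=> rk; apply: rch_step rk _ ie.
by move=> _; apply: (@rch_in _ _ _ _ _ _ (Tagged _ k')).
Qed.

Lemma adj_reachable k j : adj A B (VX m k) (VX m j) ->
  input_reachable A B k -> input_reachable A B j.
Proof.
by move=> h [i [u hu]]; exists i, u; apply: t_trans hu _; apply: t_step.
Qed.

End GraphMatching.

(** * The equivalences *)

Section Equivalences.
Variables (R : realType) (n N : nat) (m : 'I_N -> nat).
Variables (A : 'I_N -> 'M[bool]_n) (B : forall i : 'I_N, 'M[bool]_(n, m i)).

Definition matched_reachable :=
  (forall j, input_reachable A B j) /\ exists mt, edge_matching A B mt.

Lemma grank_matching : grank_is R A B n -> exists mt, edge_matching A B mt.
Proof.
move=> [[Ar [Br [rA [rB rk]]]] _].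
have [g g_inj Hg] := full_rank_transversal rk.
(* Decodes a column of the block matrix into the color and tail of an edge into [j]. *)
pose ed j (c : 'I_(\sum_(i < N) n + \sum_(i < N) m i)) : edge n m :=
  match fintype.split c with
  | inl c1 => SE m (tagnat.sig1 c1) (tagnat.sig2 c1) j
  | inr c2 => IE (tagnat.sig2 c2) j
  end.
exists (fun j => ed j (g j)); split.
- move=> j; have := Hg j; rewrite /big_AB /ed mxE.
  case: (fintype.split (g j)) => c /=; rewrite mxE => nz.
    by apply: contraNT nz => /negbTE h; rewrite (rA _ _ _ h).
  by apply: contraNT nz => /negbTE h; rewrite (rB _ _ _ h).
- by move=> j; rewrite /ed; case: fintype.split.
- move=> j j' t c; apply: g_inj; move: t c; rewrite /ed.
  case s1: (fintype.split (g j)) => [c1|c1]; case s2: (fintype.split (g j')) => [c2|c2] //= t c;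
    rewrite -(splitK (g j)) -(splitK (g j')) s1 s2; congr (unsplit (_ _)); apply: tagnat.sig_inj.
    case: t => t; rewrite !tagnat.sigE12.
    by rewrite /= c t.
  pose h (v : vtx n m) : option {i : 'I_N & 'I_(m i)} :=
    if v is VU i k then Some (Tagged (fun i => 'I_(m i)) k) else None.
  by have := congr1 h t; rewrite /= !tagnat.sigE12 => -[].
Qed.

Lemma matched_structurally_controllable : (0 < N)%N ->
  matched_reachable -> structurally_controllable R A B.
Proof.
move=> hN [Hr [mt Hmt]].
have Hrc x : x \in [set: 'I_n] -> rch [set: 'I_n] (pA A) (pB B) x.
  by move=> _; apply: input_reachable_rch.
have [Ar [b [[posA posb] full]]] := matched_rch_full R (col_matchingP Hmt) Hrc.
pose Br i : 'M[R]_(n, m i) := \matrix_(j, k) b (Tagged _ k) j 0.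
exists Ar, Br; split; [|split].
- move=> i j k Ajk; have := posA i j k.
  by rewrite /patA /pA Ajk !andbF => /eqP.
- move=> i j k Bjk; rewrite mxE; have := posb (Tagged _ k) j.
  by rewrite /patB /pB /= Bjk andbF => /eqP.
- apply: (reach_controllable (Ordinal hN)).
  suff -> : input_col Br = b by [].
  apply/funext => -[i k]; apply/matrixP => j l; rewrite ord1 !mxE //.
Qed.

(** [Q] projects onto the unreachable states. No edge leads from an input or a reachable state to
    one of them, so [Q *m Ar i = (Q *m Ar i) *m Q] and [Q *m Br i = 0]. *)
Lemma structurally_controllable_reachable j :
  structurally_controllable R A B -> input_reachable A B j.
Proof.
move=> [Ar [Br [rA [rB ctrl]]]].
pose Q : 'M[R]_n := \matrix_(a, b) ((a == b) && `[< ~ input_reachable A B a >])%:R.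
have QE p (M : 'M[R]_(n, p)) a b : (Q *m M) a b = `[< ~ input_reachable A B a >]%:R * M a b.
  rewrite mxE (bigD1 a) //= big1 ?addr0 => [|k ka]; first by rewrite mxE eqxx.
  by rewrite mxE eq_sym (negPf ka) mul0r.
have Q0 : Q = 0.
  apply: (@controllable_annihilator R n N m Ar Br n Q (fun i => Q *m Ar i)) => // i.
    apply/matrixP => a b; rewrite -mulmxA !QE; case: asboolP => [na|_]; last by rewrite !mul0r.
    rewrite !mul1r mxE (bigD1 b) //= big1 ?addr0 => [|k kb]; last first.
      by rewrite mxE (negPf kb) mulr0.
    rewrite mxE eqxx /=; case: asboolP => [_|nb]; first by rewrite mulr1.
    rewrite mulr0; apply: rA; apply: negbTE; apply/negP => Aab.
    move/contrapT: nb => rb; apply: na; apply: adj_reachable rb.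
    by exists (SE m i b a).
  apply/matrixP => a b; rewrite QE [RHS]mxE; case: asboolP => [na|_]; last by rewrite mul0r.
  rewrite mul1r; apply: rB; apply: negbTE; apply/negP => Bab; apply: na.
  by exists i, b; apply: t_step; exists (IE b a).
apply: contrapT => nj; have /matrixP/(_ j j) := Q0.
by rewrite !mxE eqxx asboolT // => /eqP; rewrite oner_eq0.
Qed.

(** The left kernel of the block matrix annihilates every [Ar i] and [Br i], so it is an annihilator
    with zero dynamics. *)
Lemma structurally_controllable_grank :
  structurally_controllable R A B -> grank_is R A B n.
Proof.
move=> [Ar [Br [rA [rB ctrl]]]]; split; last by move=> *; apply: rank_leq_row.
exists Ar, Br; split=> //; split=> //.
apply/eqP; rewrite -[_ == _]/(row_free _) -kermx_eq0; apply/eqP.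
set K := kermx _.
have : K *m big_AB Ar Br = 0 by apply: mulmx_ker.
rewrite /big_AB mul_mx_row !mul_mxrow -row_mx0 => /eq_row_mx[hA hB].
apply: (@controllable_annihilator R n N m Ar Br n K (fun=> 0)) => // i.
  by rewrite mul0mx; have := congr1 (fun M => submxrow M i) hA; rewrite mxrowK submxrow0.
by have := congr1 (fun M => submxrow M i) hB; rewrite mxrowK submxrow0.
Qed.

(** Match each state to its ingoing edge in the subgraph containing it: equal tails force the same
    subgraph, where S-disjointness applies. In a stem, the backward walk stays inside and cannot
    cycle, so it ends at an input. *)
Lemma cover_matched_reachable : has_stem_bud_cover A B -> matched_reachable.
Proof.
move=> [K [Vs [Es [HSB Hdis Hcov]]]].
have sub l : (l < K)%N -> subgraph A B (Vs l) (Es l) by move=> /HSB[[]|[]].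
have sdis l : (l < K)%N -> S_disjoint (Es l) by move=> /HSB[[]|[_ _ _ _ []]].
have ing l : (l < K)%N -> one_ingoing (Vs l) (Es l) by move=> /HSB[[]|[_ _ _ _ []]].
have /choice[f Hf] : forall j, exists f : nat * edge n m,
    [/\ (f.1 < K)%N, Vs f.1 (VX m j), Es f.1 f.2 & ehead f.2 = j].
  move=> j; have [l lK Vj] := Hcov j; have [e [Ee he _]] := ing l lK j Vj.
  by exists (l, e).
pose mt j := (f j).2.
have same l v l' : (l < K)%N -> (l' < K)%N -> Vs l v -> Vs l' v -> l = l'.
  by move=> lK l'K Vv V'v; apply: contrapT => ll'; apply: (Hdis l l' lK l'K ll' v).
have Hmt : edge_matching A B mt.
  split=> [j|j|j j' t c]; rewrite /mt.
  - by have [lK _ Ej _] := Hf j; case: (sub _ lK _ Ej).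
  - by case: (Hf j).
  - have [lK _ Ej hj] := Hf j; have [l'K _ Ej' hj'] := Hf j'.
    have [_ Vt _] := sub _ lK _ Ej; have [_ Vt' _] := sub _ l'K _ Ej'.
    rewrite -/(mt j) -/(mt j') t in Vt Vt'.
    have ll' := same _ _ _ lK l'K Vt Vt'.
    rewrite -ll' in Ej'; rewrite -hj -hj'.
    apply: contrapT => ne; have ne' : (f j).2 <> (f j').2 by move=> e; rewrite e in ne.
    by have [_ /(_ t)] := sdis _ lK _ _ Ej Ej' ne'.
split; last by exists mt.
move=> j; have [lK Vj _ _] := Hf j; set l := (f j).1 in lK Vj.
have [st|[_ _ _ H _]] := HSB l lK; last exact: H.
have inl_ y : Vs l (VX m y) -> Es l (mt y).
  move=> Vy; have [l'K V'y Ey _] := Hf y.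
  by rewrite (same l _ _ lK l'K Vy V'y).
pose par := parent (col_matching mt).
have Vpar y : Vs l (VX m y) -> Vs l (VX m (par y)).
  move=> Vy; case: (boolP (state_matched (col_matching mt) y)) => sy.
    by rewrite -(tail_state sy); case: (sub _ lK _ (inl_ y Vy)).
  by rewrite (input_matched_fix 1 sy : par y = y).
have Vit y k : Vs l (VX m y) -> Vs l (VX m (iter k par y)).
  by move=> Vy; elim: k => //= k; apply: Vpar.
have down y : input_reachable A B (par y) -> input_reachable A B y.
  case: (boolP (state_matched (col_matching mt) y)) => sy.
    apply: adj_reachable; exists (mt y); case: Hmt => h1 h2 _.
    by rewrite (tail_state sy) h2.
  by rewrite (input_matched_fix 1 sy : par y = y).
have [k] := eventually_cyclic (col_matchingP Hmt) (finset.in_setT j).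
rewrite -/par; case=> [nk|ck].
  have : input_reachable A B (iter k par j).
    have [i [u tu]] := tail_input nk; exists i, u; apply: t_step.
    by exists (mt (iter k par j)); case: Hmt => h1 h2 _; rewrite tu h2.
  by elim: k {nk} => //= k IH /down.
have [L [c cyc]] : exists L c, is_cycle (Es l) L c.
  apply: (matching_cycle Hmt ck) => y /iter_parentP[q <-].
  exact: inl_ (Vit _ _ (Vit _ _ Vj)).
by case: st => _ _ /(_ L c cyc).
Qed.

Lemma matched_reachable_cover : matched_reachable -> has_stem_bud_cover A B.
Proof.
move=> [Hr [mt Hmt]]; have [mt_edge mt_h mt_inj] := Hmt.
pose cm := col_matching mt; pose par := parent cm.
have Hcm := col_matchingP Hmt.
have per j : fconnect par (par (iter n par j)) (iter n par j).
  have /trajectP[k kl hk] := looping_order par j.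
  have kn : (k <= n)%N.
    by rewrite ltnW // (leq_trans kl) // -[X in (_ <= X)%N](card_ord n) max_card.
  have -> : iter n par j = iter (n - k) par (iter k par j) by rewrite -iterD subnK.
  set z := iter k par j.
  have hz : iter (fingraph.order par j - k) par z = z.
    by rewrite /z -iterD subnK // ltnW.
  apply/iter_parentP; exists (fingraph.order par j - k).-1.
  by rewrite -iterSr prednK ?subn_gt0 // -iterD addnC iterD hz.
(* After [n] backward steps the walk is on its terminal loop; this loop labels the component of
   [j]. *)
pose cl j := orb cm (iter n par j).
have cl_par j : cl (par j) = cl j.
  apply/finset.setP => y; rewrite !inE -iterSr iterS; apply/idP/idP => h.
    by apply: connect_trans h; apply: fconnect1.
  by apply: connect_trans h; apply: per.
have cl_iter k j : cl (iter k par j) = cl j by elim: k => //= k <-.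
have cl_in j k : iter (k + n) par j \in cl j.
  by rewrite inE iterD; apply: fconnect_iter.
have cl_input j : ~~ state_matched cm j -> cl j = [set j].
  move=> nj; rewrite /cl input_matched_fix //; apply/finset.setP => y.
  rewrite !inE; apply/iter_parentP/eqP => [[k]|->]; last by exists 0%N.
  by rewrite input_matched_fix.
pose s := undup (codom cl); pose X l := nth finset.set0 s l.
pose Vs l (v : vtx n m) := match v with
  | VX j => cl j = X l
  | VU i k => exists2 j, cl j = X l & etail (mt j) = VU n k end.
pose Es l e := exists2 j, cl j = X l & mt j = e.
have EsE l e : Es l e -> e = mt (ehead e) by case=> j _ <-; rewrite mt_h.
have sub l : subgraph A B (Vs l) (Es l).
  move=> _ [j cj <-]; split=> //=; last by rewrite mt_h.
  case: (boolP (state_matched cm j)) => sj; first by rewrite (tail_state sj) /= cl_par.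
  by have [i [k tj]] := tail_input sj; rewrite tj; exists j.
have ing l : one_ingoing (Vs l) (Es l).
  move=> j cj; exists (mt j); split=> //; first by exists j.
  by move=> _ [j' _ <-]; rewrite mt_h => ->.
have sdis l : S_disjoint (Es l).
  move=> _ _ [j1 _ <-] [j2 _ <-] ne; rewrite !mt_h; split.
    by move=> e; rewrite e in ne.
  by move=> t c; apply: ne; rewrite (mt_inj _ _ t c).
(* Any cycle in a component has as edges exactly the matched edges into its loop, which makes it
   unique. *)
have cyc_edges l L c e : is_cycle (Es l) L c ->
    cycle_edges L c e <-> exists2 h, h \in X l & mt h = e.
  move=> cyc; have hd : forall q, (q < L)%N ->
      state_matched cm (ehead (c q)) /\ par (ehead (c q)) = ehead (c ((q + L.-1) %% L)%N).
    exact: (cycle_head Hmt (@EsE l) cyc).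
  have [L0 cE _ _] := cyc.
  have clh q : (q < L)%N -> cl (ehead (c q)) = X l.
    by move=> /cE [j cj <-]; rewrite mt_h.
  have it k q : (q < L)%N ->
      iter k par (ehead (c q)) = ehead (c ((q + k * L.-1) %% L)%N).
    move=> qL; elim: k => [|k IH]; first by rewrite mul0n addn0 modn_small.
    rewrite iterS IH (hd _ _).2 ?ltn_mod // modnDml mulSn -addnA [(_ * _ + _)%N]addnC.
    by [].
  split=> [[q qL <-]|[h hX <-]].
    exists (ehead (c q)); last by rewrite -(EsE l) //; apply: cE.
    rewrite -(clh q qL).
    have perq : iter L par (ehead (c q)) = ehead (c q).
      by rewrite it // addnC mulnC modnMDl modn_small.
    (* [n * L] is a multiple of the period and at least [n], so the walk is back at its start and
       already on the loop. *)
    have := cl_in (ehead (c q)) (n * L - n)%N; rewrite subnK ?leq_pmulr //.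
    case: L L0 perq {cyc cE hd clh it qL} => // L _ perq.
    by rewrite iter_mulSn_fix.
  move: hX; rewrite -(clh 0%N L0) inE it // => /iter_parentP[k <-].
  rewrite it ?ltn_mod //; set q := (_ %% L)%N; have qL : (q < L)%N by rewrite ltn_mod.
  by exists q => //; rewrite -(EsE l) //; apply: cE.
have Xcl l : (l < size s)%N -> exists j, X l = cl j.
  move=> ls; have : X l \in codom cl by rewrite -mem_undup; apply: mem_nth.
  by move=> /codomP[j ->]; exists j.
exists (size s), Vs, Es; split.
- move=> l ls; have [j0 Xj] := Xcl l ls; pose y := iter n par j0.
  have cly : cl y = X l by rewrite Xj cl_iter.
  (* A genuine loop gives a bud; a loop that is a single input-matched vertex gives a stem. *)
  case: (boolP (state_matched cm y)) => sy.
    have cy : cyclic [set: 'I_n] cm y by rewrite /cyclic finset.in_setT sy per.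
    have sX h : h \in X l -> state_matched cm h.
      by rewrite Xj inE => yh; case/and3P: (cyclic_orb Hcm cy yh).
    right; split=> //.
      move=> i k /= [j cj tj].
      have nj : ~~ state_matched cm j by apply/negP => /tail_state; rewrite tj.
      by case/negP: (nj); apply: sX; rewrite -cj cl_input // inE.
    have [L [c cyc]] : exists L c, is_cycle (Es l) L c.
      apply: (matching_cycle Hmt cy) => z /iter_parentP[k <-].
      by exists (iter k par y) => //; rewrite cl_iter.
    exists L, c; split=> // L' c' cyc' e.
    by rewrite (cyc_edges l L' c' e cyc') (cyc_edges l L c e cyc).
  left; split=> //.
    have [i [k ty]] := tail_input sy; exists i, k; split; first by exists y.
    move=> i' k' /= [j cj tj].
    have nj : ~~ state_matched cm j by apply/negP => /tail_state; rewrite tj.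
    have : j \in [set y] by rewrite -(cl_input y) // cly -cj cl_input // inE.
    by rewrite inE => /eqP jy; rewrite -ty -tj jy.
  move=> L c cyc.
  have yX : y \in X l by rewrite -cly cl_input // inE.
  have [q qL eq] := (cyc_edges l L c (mt y) cyc).2 (ex_intro2 _ _ y yX erefl).
  have := (cycle_head Hmt (@EsE l) cyc qL).1; rewrite eq mt_h.
  exact/negP.
- move=> l1 l2 h1 h2 ne v V1 V2; apply: ne.
  suff : X l1 = X l2 by move/eqP; rewrite /X nth_uniq ?undup_uniq // => /eqP.
  case: v V1 V2 => [j /= <- <- //|i k /= [j1 <- t1] [j2 <- t2]].
  congr cl; apply: mt_inj; first by rewrite t1 t2.
  (* Two edges leaving the same input vertex have the same color, so they are matched to the same
     state. *)
  have ec (e : edge n m) (i' : 'I_N) (k' : 'I_(m i')) : etail e = VU n k' -> ecolor e = i'.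
    by case: e => //= i1 k1 _ e; have := congr1 (fun v : vtx n m =>
      if v is VU i _ then i else i') e.
  by rewrite (ec _ _ _ t1) (ec _ _ _ t2).
- move=> j; exists (index (cl j) s); first by rewrite index_mem mem_undup codom_f.
  by rewrite /= /X nth_index // mem_undup codom_f.
Qed.

End Equivalences.

Theorem theorem2 (R : realType) (n N : nat) (m : 'I_N -> nat)
    (A : 'I_N -> 'M[bool]_n) (B : forall i : 'I_N, 'M[bool]_(n, m i))
    (hN : (0 < N)%N) :
  let a := (forall j : 'I_n, input_reachable A B j) /\ grank_is R A B n in
  let b := has_stem_bud_cover A B in
  let c := structurally_controllable R A B in
  (a <-> b) /\ (b <-> c).
Proof.
move=> a b c.
have ab : a -> b.
  by move=> [ra /grank_matching rk]; apply: matched_reachable_cover.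
have bc : b -> c.
  by move=> /cover_matched_reachable; apply: matched_structurally_controllable.
have ca : c -> a.
  move=> sc; split; last exact: structurally_controllable_grank.
  by move=> j; apply: structurally_controllable_reachable sc.
by split; split; [exact: ab|move=> /bc/ca|exact: bc|move=> /ca/ab].
Qed.
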